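(* Let $b_1$ and $b_2$ be one-variable finite Blaschke products with simple zeros $z_1,\dots,z_n$ and $w_1,\dots,w_n$ in $\mathbb D$, respectively. Let $G_1,G_2\in H^\infty(\mathbb T)$ and put $\phi(x,y)=\overline{b_1(x)}\,\overline{b_2(y)}\,G_1(x)G_2(y)$. Let $\Gamma^\phi:K_{b_1b_2}\to K_{b_1b_2}$ be the multiplier defined on $e\in K_{b_1b_2}$, written as $$e=\sum_{i,j=1}^nc_{ij}\xi_i(x)\eta_j(y)+\sum_{i=1}^n\xi_i(x)b_2(y)h_i''(y)+\sum_{j=1}^n\eta_j(y)b_1(x)h_j'(x),$$ by $$\Gamma^\phi e=\sum_{i,j}c_{ij}\big(G_1(x)G_2(w_j)+G_1(z_i)G_2(y)-G_1(z_i)G_2(w_j)\big)\xi_i(x)\eta_j(y)+\sum_iG_1(z_i)G_2(y)\xi_i(x)b_2(y)h_i''(y)+\sum_jG_1(x)G_2(w_j)\eta_j(y)b_1(x)h_j'(x).$$ Then $\|\Gamma^\phi\|=\|\Gamma_\phi\|$, where $\Gamma_\phi:H^2(\mathbb T^2)\to H^2(\mathbb T^2)^\perp$ is the big Hankel operator with symbol $\phi$.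
   Context: $\mathbb T$ is the unit circle with normalized Lebesgue measure; $x,y\in\mathbb T$ are identified with points $e^{ix},e^{iy}$ of the unit circle. $P$ is the orthogonal projection of $L^2(\mathbb T^2)$ onto $H^2(\mathbb T^2)$, and $\Gamma_\phi f=(I-P)(\phi f)$. $K_{b_1b_2}=H^2(\mathbb T^2)\ominus b_1(x)b_2(y)H^2(\mathbb T^2)$. Define $$\xi_i(x)=\frac{b_1(e^{ix})}{e^{ix}-z_i},\qquad \eta_j(y)=\frac{b_2(e^{iy})}{e^{iy}-w_j}.$$ These are eigenfunctions of the one-variable model operators: $\{\xi_i\}$ is a basis of $H^2(\mathbb T)\ominus b_1H^2(\mathbb T)$ and $\{\eta_j\}$ is a basis of $H^2(\mathbb T)\ominus b_2H^2(\mathbb T)$. Every $e\in K_{b_1b_2}$ has a unique representation of the displayed form, with $c_{ij}\in\mathbb C$ and $h_j',h_i''\in H^2(\mathbb T)$ one-variable functions. This comes from the orthogonal decomposition $$K_{b_1b_2}=(K_{b_1}\otimes K_{b_2})\oplus(K_{b_1}\otimes b_2H^2)\oplus(b_1H^2\otimes K_{b_2}),\qquad K_{b_k}=H^2(\mathbb T)\ominus b_kH^2(\mathbb T).$$ $\Gamma^\phi$ is defined by the displayed formula and extended linearly; norms are $L^2(\mathbb T^2)$ operator norms. *)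

(* Defs.v *)
From HB Require Import structures.
From mathcomp Require Import all_boot all_order all_algebra.
From mathcomp Require Import all_classical all_reals all_analysis.
From mathcomp Require Import complex.
Set Implicit Arguments. Unset Strict Implicit. Unset Printing Implicit Defensive.
Import Order.TTheory GRing.Theory Num.Theory.
Import numFieldNormedType.Exports.
Local Open Scope classical_set_scope.
Local Open Scope ring_scope.

(* The circle T is parametrized by the angle t in [0, 2pi], t <-> e^{it};
   the (normalized) Lebesgue measure on T is dt/(2 pi), on T^2 dx dy/(4 pi^2). *)

Definition cabs (R : realType) (z : complex R) : R :=
  Num.sqrt (complex.Re z ^+ 2 + complex.Im z ^+ 2).

Definition ei (R : realType) (t : R) : complex R := Complex (cos t) (sin t).

Definition I1 (R : realType) : set R := `[0, 2 * pi]%classic.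
Definition I2 (R : realType) : set (R * R) := @I1 R `*` @I1 R.

Definition leb (R : realType) := @lebesgue_measure R.
Definition leb2 (R : realType) := (@lebesgue_measure R \x @lebesgue_measure R)%E.

Definition cint1 (R : realType) (f : R -> complex R) : complex R :=
  Complex ((2 * pi)^-1 * Rintegral (@leb R) (@I1 R) (fun t => complex.Re (f t)))
          ((2 * pi)^-1 * Rintegral (@leb R) (@I1 R) (fun t => complex.Im (f t))).

Definition cint2 (R : realType) (f : R -> R -> complex R) : complex R :=
  Complex ((2 * pi)^-2 * Rintegral (@leb2 R) (@I2 R) (fun p => complex.Re (f p.1 p.2)))
          ((2 * pi)^-2 * Rintegral (@leb2 R) (@I2 R) (fun p => complex.Im (f p.1 p.2))).

Definition sqnorm1 (R : realType) (f : R -> complex R) : \bar R :=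
  (((2 * pi)^-1)%:E *
    \int[@leb R]_(t in @I1 R) ((complex.Re (f t)) ^+ 2 + (complex.Im (f t)) ^+ 2)%:E)%E.
Definition sqnorm2 (R : realType) (f : R -> R -> complex R) : \bar R :=
  (((2 * pi)^-2)%:E *
    \int[@leb2 R]_(p in @I2 R)
       ((complex.Re (f p.1 p.2)) ^+ 2 + (complex.Im (f p.1 p.2)) ^+ 2)%:E)%E.

(* L^2 norm on T^2 (meaningful for f in L^2(T^2)) *)
Definition l2norm2 (R : realType) (f : R -> R -> complex R) : R :=
  Num.sqrt (fine (sqnorm2 f)).

Definition L2_1 (R : realType) (f : R -> complex R) : Prop :=
  measurable_fun (@I1 R) (fun t => complex.Re (f t)) /\
  measurable_fun (@I1 R) (fun t => complex.Im (f t)) /\ (sqnorm1 f < +oo)%E.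

Definition L2_2 (R : realType) (f : R -> R -> complex R) : Prop :=
  measurable_fun (@I2 R) (fun p => complex.Re (f p.1 p.2)) /\
  measurable_fun (@I2 R) (fun p => complex.Im (f p.1 p.2)) /\ (sqnorm2 f < +oo)%E.

(* H^2(T): L^2 functions whose negative Fourier coefficients vanish:
   hat h (-k) = int h(t) e^{ikt} dt/2pi = 0 for k >= 1 *)
Definition H2_1 (R : realType) (h : R -> complex R) : Prop :=
  L2_1 h /\ forall k : nat, (0 < k)%N -> cint1 (fun t => h t * ei (k%:R * t)) = 0.

Definition H2_2 (R : realType) (f : R -> R -> complex R) : Prop :=
  L2_2 f /\ forall m n : int, (m < 0)%R \/ (n < 0)%R ->
    cint2 (fun x y => f x y * ei (- (m%:~R * x + n%:~R * y))) = 0.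

Definition Hinf (R : realType) (G : R -> complex R) : Prop :=
  measurable_fun (@I1 R) (fun t => complex.Re (G t)) /\
  measurable_fun (@I1 R) (fun t => complex.Im (G t)) /\
  (exists M : R, {ae @leb R, forall t, (@I1 R) t -> cabs (G t) <= M}) /\
  forall k : nat, (0 < k)%N -> cint1 (fun t => G t * ei (k%:R * t)) = 0.

(* value at z in the unit disc of the analytic extension of G in H^oo
   (Cauchy integral: G(z) = int G(e^{it}) / (1 - z e^{-it}) dt/2pi) *)
Definition hext (R : realType) (G : R -> complex R) (z : complex R) : complex R :=
  cint1 (fun t => G t / (1 - z * (ei t)^*%C)).

Definition blaschke (R : realType) (n : nat) (lam : complex R) (z : 'I_n -> complex R)
  (w : complex R) : complex R :=
  lam * \prod_(i < n) ((w - z i) / (1 - (z i)^*%C * w)).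

Definition is_blaschke_simple (R : realType) (n : nat) (lam : complex R)
  (z : 'I_n -> complex R) : Prop :=
  cabs lam = 1 /\ (forall i, cabs (z i) < 1) /\ injective z.

Definition inner2 (R : realType) (f g : R -> R -> complex R) : complex R :=
  cint2 (fun x y => f x y * (g x y)^*%C).
Definition is_projH2 (R : realType) (g h : R -> R -> complex R) : Prop :=
  H2_2 h /\ forall k, H2_2 k -> inner2 (fun x y => g x y - h x y) k = 0.

Definition hankel_norm (R : realType) (phi : R -> R -> complex R) : \bar R :=
  ereal_sup [set r | exists f h : R -> R -> complex R,
    [/\ H2_2 f, l2norm2 f <= 1,
        is_projH2 (fun x y => phi x y * f x y) h &
        r = (l2norm2 (fun x y => phi x y * f x y - h x y))%:E]].

Definition xi (R : realType) (n : nat) (b : complex R -> complex R) (z : 'I_n -> complex R)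
  (i : 'I_n) (x : R) : complex R := b (ei x) / (ei x - z i).

Definition Kelt (R : realType) (n : nat) (b1 b2 : complex R -> complex R)
  (z w : 'I_n -> complex R) (c : 'I_n -> 'I_n -> complex R) (h' h'' : 'I_n -> R -> complex R)
  (x y : R) : complex R :=
  \sum_(i < n) \sum_(j < n) c i j * xi b1 z i x * xi b2 w j y
  + \sum_(i < n) xi b1 z i x * b2 (ei y) * h'' i y
  + \sum_(j < n) xi b2 w j y * b1 (ei x) * h' j x.

Definition Gamma_sup (R : realType) (n : nat) (b1 b2 : complex R -> complex R)
  (z w : 'I_n -> complex R) (G1 G2 : R -> complex R)
  (c : 'I_n -> 'I_n -> complex R) (h' h'' : 'I_n -> R -> complex R) (x y : R) : complex R :=
  \sum_(i < n) \sum_(j < n) c i j *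
     (G1 x * hext G2 (w j) + hext G1 (z i) * G2 y - hext G1 (z i) * hext G2 (w j))
     * xi b1 z i x * xi b2 w j y
  + \sum_(i < n) hext G1 (z i) * G2 y * xi b1 z i x * b2 (ei y) * h'' i y
  + \sum_(j < n) G1 x * hext G2 (w j) * xi b2 w j y * b1 (ei x) * h' j x.

(* operator norm of Gamma^phi on K_{b1 b2}; every e in K_{b1 b2} is Kelt of
   a unique (c, h', h'') with h'_j, h''_i in H^2(T) *)
Definition Gamma_sup_norm (R : realType) (n : nat) (b1 b2 : complex R -> complex R)
  (z w : 'I_n -> complex R) (G1 G2 : R -> complex R) : \bar R :=
  ereal_sup [set r | exists (c : 'I_n -> 'I_n -> complex R) (h' h'' : 'I_n -> R -> complex R),
    [/\ forall j, H2_1 (h' j), forall i, H2_1 (h'' i),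
        l2norm2 (Kelt b1 b2 z w c h' h'') <= 1 &
        r = (l2norm2 (Gamma_sup b1 b2 z w G1 G2 c h' h''))%:E]].

(* Main.v *)
(* Write B = b1(x) b2(y) and let K be the orthogonal complement of B H^2 in H^2.
   Since |B| = 1 on the torus, multiplication by conj B maps B H^2 onto H^2 and K into
   the orthogonal complement of H^2.

   As (G1 - G1(z_i)) / (x - z_i) is in H^2, (G1 - G1(z_i)) xi_i is in b1 H^2, and
   likewise for G2 and eta_j; expanding the product G1 G2 around these values gives
   G1 G2 e = Gamma^phi e + B r with r in H^2 and Gamma^phi e in K.  Interpolating at the
   zeros in each variable, every f in H^2 is e + B q with e in K of the displayed form
   and q in H^2.  Hence phi f = conj B (Gamma^phi e) + (r + G1 G2 q), where the first
   summand is orthogonal to H^2 and the second one is in H^2: so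
   |Gamma_phi f| = |Gamma^phi e|, while |e| <= |f| with equality for f = e.

   The products G u, for G bounded analytic and u in H^2, stay in H^2 because
   trigonometric polynomials are dense in L^2: the indicator of an arc is a bounded
   pointwise limit of the trigonometric polynomials (1 - p^N)^(2^N), where p crosses
   the value 1/2 exactly at the end points of the arc. *)

(* Functions are actual functions, not classes modulo null sets, so [is_projH2] is a relation that
   many [h] may satisfy, and no projection operator is built: an explicit [h] is exhibited each
   time, and any other one leaves a remainder of the same norm.

   Values in the disc are Cauchy integrals, and no power series is summed. The geometric series of
   the Cauchy kernel is unfolded by a single term; this relates consecutive integrals by a factor
   [z], and boundedness does the rest. Membership of the difference quotients in H^2 follows from
   such relations alone.

   Every multiplier and every kernel depends on one variable only. Density of trigonometric
   polynomials is therefore needed on the circle and never on the torus: the other variable is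
   carried along as a parameter.

   Simplicity of the zeros enters through the partial fractions of [1 / b], which then have simple
   poles only; their residues are the interpolation coefficients. *)
Require Import Defs.
From HB Require Import structures.
From mathcomp Require Import all_boot all_order all_algebra.
From mathcomp Require Import all_classical all_reals all_analysis.
From mathcomp Require Import measurable_realfun complex ring lra.
Set Implicit Arguments. Unset Strict Implicit. Unset Printing Implicit Defensive.
Import Order.TTheory GRing.Theory Num.Theory.
Import numFieldNormedType.Exports.
Local Open Scope classical_set_scope.
Local Open Scope ring_scope.

(** * Real and imaginary parts, squared modulus *)

Section ComplexModulus.
Variable R : realType.
Implicit Types a b z : complex R.

(** Convertible to the integrands of [sqnorm1] and [sqnorm2] and to the radicand of [cabs]; being
    polynomial in both parts, it is within reach of [ring] and [nra]. *)
Definition sqm z : R := complex.Re z ^+ 2 + complex.Im z ^+ 2.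

Lemma ReM a b : complex.Re (a * b) =
  complex.Re a * complex.Re b - complex.Im a * complex.Im b.
Proof. by case: a; case: b. Qed.

Lemma ImM a b : complex.Im (a * b) =
  complex.Re a * complex.Im b + complex.Im a * complex.Re b.
Proof. by case: a; case: b. Qed.

Lemma ReD a b : complex.Re (a + b) = complex.Re a + complex.Re b.
Proof. by case: a; case: b. Qed.

Lemma ImD a b : complex.Im (a + b) = complex.Im a + complex.Im b.
Proof. by case: a; case: b. Qed.

Lemma ReN a : complex.Re (- a) = - complex.Re a.
Proof. by case: a. Qed.

Lemma ImN a : complex.Im (- a) = - complex.Im a.
Proof. by case: a. Qed.

Lemma ReV a : complex.Re a^-1 = complex.Re a / sqm a.
Proof. by case: a. Qed.

Lemma ImV a : complex.Im a^-1 = - complex.Im a / sqm a.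
Proof. by case: a => x y /=; rewrite /sqm /= mulNr. Qed.

Lemma ReJ a : complex.Re (conjc a) = complex.Re a.
Proof. by case: a. Qed.

Lemma ImJ a : complex.Im (conjc a) = - complex.Im a.
Proof. by case: a. Qed.

Lemma complexP a b : complex.Re a = complex.Re b ->
  complex.Im a = complex.Im b -> a = b.
Proof. by case: a; case: b => ? ? ? ? /= -> ->. Qed.

Lemma conjcM a b : conjc (a * b) = conjc a * conjc b.
Proof. by apply: complexP; rewrite ?(ReJ, ImJ, ReM, ImM); ring. Qed.

Lemma conjcD a b : conjc (a + b) = conjc a + conjc b.
Proof. by apply: complexP; rewrite ?(ReJ, ImJ, ReD, ImD) // opprD. Qed.

Lemma conjcN a : conjc (- a) = - conjc a.
Proof. by apply: complexP; rewrite ?(ReJ, ImJ, ReN, ImN). Qed.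

Lemma conjcB a b : conjc (a - b) = conjc a - conjc b.
Proof. by rewrite conjcD conjcN. Qed.

Lemma conjc_one : conjc (1 : complex R) = 1.
Proof. by apply: complexP; rewrite /= ?oppr0. Qed.

Lemma sqm_ge0 z : 0 <= sqm z.
Proof. by rewrite addr_ge0 ?sqr_ge0. Qed.

Lemma sqm0 : sqm 0 = 0.
Proof. by rewrite /sqm /= expr0n /= addr0. Qed.

Lemma sqm1 : sqm 1 = 1.
Proof. by rewrite /sqm /= expr0n /= addr0 expr1n. Qed.

Lemma sqm_eq0 z : sqm z = 0 -> z = 0.
Proof.
move=> /eqP; rewrite paddr_eq0 ?sqr_ge0 // !sqrf_eq0 => /andP[/eqP ? /eqP ?].
exact: complexP.
Qed.

Lemma sqmM a b : sqm (a * b) = sqm a * sqm b.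
Proof. by rewrite /sqm ReM ImM; ring. Qed.

Lemma sqmJ z : sqm (conjc z) = sqm z.
Proof. by rewrite /sqm ReJ ImJ sqrrN. Qed.

Lemma sqmN z : sqm (- z) = sqm z.
Proof. by rewrite /sqm ReN ImN !sqrrN. Qed.

Lemma sqmV z : sqm z^-1 = (sqm z)^-1.
Proof.
have [->|z0] := eqVneq z 0; first by rewrite invr0 sqm0 invr0.
have s0 : sqm z != 0 by apply: contra_neq z0; exact: sqm_eq0.
by apply: (mulfI s0); rewrite -sqmM !divff // sqm1.
Qed.

Lemma sqmX z k : sqm (z ^+ k) = sqm z ^+ k.
Proof. by elim: k => [|k IH]; rewrite ?expr0 ?sqm1 // !exprS sqmM IH. Qed.

Lemma sqmD a b : sqm (a + b) = sqm a + sqm b + 2 * complex.Re (a * (conjc b)).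
Proof. by rewrite /sqm ReM ReD ImD ReJ ImJ; ring. Qed.

Lemma sqmD_le a b : sqm (a + b) <= 2 * sqm a + 2 * sqm b.
Proof.
rewrite -subr_ge0.
have -> : 2 * sqm a + 2 * sqm b - sqm (a + b) = sqm (a - b).
  by rewrite /sqm !(ReD, ImD, ReN, ImN); ring.
exact: sqm_ge0.
Qed.

Lemma mul_conjc z : z * (conjc z) = (sqm z)%:C%C.
Proof. by apply: complexP; rewrite ?(ReM, ImM, ReJ, ImJ) /sqm /=; ring. Qed.

(** With its companion for the imaginary part, this dominates a product of two square integrable
    functions by an integrable one. *)
Lemma normReM_le a b : `|complex.Re (a * b)| <= sqm a + sqm b.
Proof.
rewrite ReM /sqm; case: a => x y; case: b => u v /=; rewrite ler_norml.
have := sqr_ge0 (x - u); have := sqr_ge0 (x + u).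
have := sqr_ge0 (y - v); have := sqr_ge0 (y + v).
by nra.
Qed.

Lemma normImM_le a b : `|complex.Im (a * b)| <= sqm a + sqm b.
Proof.
rewrite ImM /sqm; case: a => x y; case: b => u v /=; rewrite ler_norml.
have := sqr_ge0 (x - v); have := sqr_ge0 (x + v).
have := sqr_ge0 (y - u); have := sqr_ge0 (y + u).
by nra.
Qed.

Lemma cabsE z : cabs z = Num.sqrt (sqm z).
Proof. by []. Qed.

Lemma sqm_cabs z : sqm z = cabs z ^+ 2.
Proof. by rewrite cabsE sqr_sqrtr // sqm_ge0. Qed.

Lemma sqm_lt1 z : cabs z < 1 -> sqm z < 1.
Proof. by move=> z1; rewrite sqm_cabs expr_lt1 // cabsE sqrtr_ge0. Qed.

End ComplexModulus.

(** * Complex-valued integration on a set of finite measure *)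

Section ComplexIntegral.
Context (d : measure_display) (X : measurableType d) (R : realType).
Variables (mu : {measure set X -> \bar R}) (D : set X) (kap : R).
Hypotheses (mD : measurable D) (kap0 : 0 <= kap) (finD : (mu D < +oo)%E).
Implicit Types f g h : X -> complex R.

(** Measure, domain and normalizing factor [kap] stay abstract in these notions, since the same
    lemmas serve the circle and the torus. *)
Definition cmeas f := measurable_fun D (fun t => complex.Re (f t)) /\
  measurable_fun D (fun t => complex.Im (f t)).

Definition cL1 f := mu.-integrable D (fun t => (complex.Re (f t))%:E) /\
  mu.-integrable D (fun t => (complex.Im (f t))%:E).

Definition cL2 f := cmeas f /\ mu.-integrable D (fun t => (sqm (f t))%:E).

Definition cint f : complex R :=
  Complex (kap * Rintegral mu D (fun t => complex.Re (f t)))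
          (kap * Rintegral mu D (fun t => complex.Im (f t))).

Definition sqN f : R := kap * Rintegral mu D (fun t => sqm (f t)).

Lemma cmeas_cst c : cmeas (fun=> c).
Proof. by split; exact: measurable_cst. Qed.

Lemma cmeasD f g : cmeas f -> cmeas g -> cmeas (fun t => f t + g t).
Proof.
move=> [f1 f2] [g1 g2]; split.
  by under eq_fun do rewrite ReD; exact: measurable_funD.
by under eq_fun do rewrite ImD; exact: measurable_funD.
Qed.

Lemma cmeasN f : cmeas f -> cmeas (fun t => - f t).
Proof.
move=> [f1 f2]; split.
  by under eq_fun do rewrite ReN; exact: measurable_funN.
by under eq_fun do rewrite ImN; exact: measurable_funN.
Qed.

Lemma cmeasB f g : cmeas f -> cmeas g -> cmeas (fun t => f t - g t).
Proof. by move=> mf mg; apply: cmeasD => //; exact: cmeasN. Qed.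

Lemma cmeasJ f : cmeas f -> cmeas (fun t => conjc (f t)).
Proof.
move=> [f1 f2]; split.
  by under eq_fun do rewrite ReJ.
by under eq_fun do rewrite ImJ; exact: measurable_funN.
Qed.

Lemma cmeasM f g : cmeas f -> cmeas g -> cmeas (fun t => f t * g t).
Proof.
move=> [f1 f2] [g1 g2]; split.
  by under eq_fun do rewrite ReM; apply: measurable_funB; exact: measurable_funM.
by under eq_fun do rewrite ImM; apply: measurable_funD; exact: measurable_funM.
Qed.

Lemma cmeas_sqm f : cmeas f -> measurable_fun D (fun t => sqm (f t)).
Proof.
by move=> [f1 f2]; apply: measurable_funD; exact: measurable_funX.
Qed.

(** Inversion is not continuous at 0, so measurability is borrowed from the real power with exponent
    -1, which agrees with it on nonnegative numbers. *)
Lemma measurable_funV_ge0 (h : X -> R) : (forall t, 0 <= h t) ->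
  measurable_fun D h -> measurable_fun D (fun t => (h t)^-1).
Proof.
move=> h0 mh; under eq_fun do rewrite -powR_inv1 //.
exact: measurableT_comp (measurable_powR _) mh.
Qed.

Lemma cmeasV f : cmeas f -> cmeas (fun t => (f t)^-1).
Proof.
move=> mf; have ms : measurable_fun D (fun t => (sqm (f t))^-1).
  by apply: measurable_funV_ge0 => [t|]; [exact: sqm_ge0|exact: cmeas_sqm].
case: mf => f1 f2; split.
  by under eq_fun do rewrite ReV; exact: measurable_funM.
under eq_fun do rewrite ImV; apply: measurable_funM => //.
exact: measurable_funN.
Qed.

Lemma cmeas_prod (I : Type) (r : seq I) (P : pred I) (F : I -> X -> complex R) :
  (forall i, cmeas (F i)) -> cmeas (fun t => \prod_(i <- r | P i) F i t).
Proof.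
move=> mF; elim: r => [|i r IH].
  by rewrite (_ : (fun t => _) = fun=> 1); [exact: cmeas_cst|apply/funext => t; rewrite big_nil].
have [Pi|Pi] := boolP (P i); last first.
  by move: IH; congr cmeas; apply/funext => t; rewrite big_cons (negbTE Pi).
move: (cmeasM (mF i) IH); congr cmeas.
by apply/funext => t; rewrite big_cons Pi.
Qed.

Lemma cL1_meas f : cL1 f -> cmeas f.
Proof.
by move=> [f1 f2]; split; apply/measurable_EFinP; exact: measurable_int f1 || exact: measurable_int f2.
Qed.

Lemma cL1_dom f (g : X -> R) : cmeas f -> mu.-integrable D (EFin \o g) ->
  (forall t, D t -> `|complex.Re (f t)| <= g t) ->
  (forall t, D t -> `|complex.Im (f t)| <= g t) -> cL1 f.
Proof.
move=> [f1 f2] ig b1 b2; split; apply: (le_integrable mD _ _ ig).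
- exact/measurable_EFinP.
- by move=> t Dt /=; rewrite lee_fin (le_trans (b1 _ Dt)) // ler_norm.
- exact/measurable_EFinP.
- by move=> t Dt /=; rewrite lee_fin (le_trans (b2 _ Dt)) // ler_norm.
Qed.

Lemma cL2_dom f (g : X -> R) : cmeas f -> mu.-integrable D (EFin \o g) ->
  (forall t, D t -> sqm (f t) <= g t) -> cL2 f.
Proof.
move=> mf ig b; split => //; apply: (le_integrable mD _ _ ig).
- exact/measurable_EFinP/cmeas_sqm.
- move=> t Dt /=; rewrite lee_fin ger0_norm ?sqm_ge0 //.
  by rewrite (le_trans (b _ Dt)) // ler_norm.
Qed.

Lemma integrableD_EFin (g h : X -> R) : mu.-integrable D (EFin \o g) ->
  mu.-integrable D (EFin \o h) -> mu.-integrable D (EFin \o (fun t => g t + h t)).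
Proof. by move=> ig ih; exact: (integrableD mD ig ih). Qed.

Lemma integrableZ_EFin (k : R) (g : X -> R) : mu.-integrable D (EFin \o g) ->
  mu.-integrable D (EFin \o (fun t => k * g t)).
Proof. by move=> ig; exact: (integrableZl mD k ig). Qed.

Lemma integrable_cst_EFin (k : R) : mu.-integrable D (EFin \o (fun=> k)).
Proof.
apply/integrableP; split; first exact/measurable_EFinP/measurable_cst.
rewrite (eq_integral (cst `|k|%:E)) // lebesgue_integral_nonneg.integral_cst //.
by rewrite lte_mul_pinfty ?lee_fin.
Qed.

Lemma cL2_bounded f (M : R) : cmeas f -> (forall t, D t -> sqm (f t) <= M) -> cL2 f.
Proof. by move=> mf b; exact: (cL2_dom mf (integrable_cst_EFin M)). Qed.

Lemma cL2_cst c : cL2 (fun=> c).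
Proof. by apply: (@cL2_bounded _ (sqm c)) => //; exact: cmeas_cst. Qed.

Lemma cL1_cL2M f g : cL2 f -> cL2 g -> cL1 (fun t => f t * g t).
Proof.
move=> [mf if_] [mg ig].
apply: (cL1_dom (cmeasM mf mg) (integrableD_EFin if_ ig)) => t _.
  exact: normReM_le.
exact: normImM_le.
Qed.

Lemma cL2_cL1 f : cL2 f -> cL1 f.
Proof.
move=> Lf; have := cL1_cL2M Lf (cL2_cst 1); congr cL1.
by apply/funext => t; rewrite mulr1.
Qed.

Lemma cL2D f g : cL2 f -> cL2 g -> cL2 (fun t => f t + g t).
Proof.
move=> [mf if_] [mg ig]; apply: (cL2_dom (cmeasD mf mg) (integrableD_EFin
  (integrableZ_EFin 2 if_) (integrableZ_EFin 2 ig))) => t _.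
exact: sqmD_le.
Qed.

Lemma cL2N f : cL2 f -> cL2 (fun t => - f t).
Proof.
move=> [mf if_]; apply: (cL2_dom (cmeasN mf) if_) => t _.
by rewrite sqmN.
Qed.

Lemma cL2B f g : cL2 f -> cL2 g -> cL2 (fun t => f t - g t).
Proof. by move=> L2f L2g; apply: cL2D => //; exact: cL2N. Qed.

Lemma cL2J f : cL2 f -> cL2 (fun t => conjc (f t)).
Proof.
move=> [mf if_]; apply: (cL2_dom (cmeasJ mf) if_) => t _.
by rewrite sqmJ.
Qed.

Lemma cL2Ml (M : R) f g : cmeas f -> (forall t, D t -> sqm (f t) <= M) ->
  cL2 g -> cL2 (fun t => f t * g t).
Proof.
move=> mf b [mg ig]; apply: (cL2_dom (cmeasM mf mg) (integrableZ_EFin M ig)).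
by move=> t Dt; rewrite sqmM ler_wpM2r ?sqm_ge0 // b.
Qed.

Lemma cL2Z c f : cL2 f -> cL2 (fun t => c * f t).
Proof. by apply: (@cL2Ml (sqm c)) => //; exact: cmeas_cst. Qed.

Lemma cL2_sum (I : Type) (r : seq I) (P : pred I) (F : I -> X -> complex R) :
  (forall i, cL2 (F i)) -> cL2 (fun t => \sum_(i <- r | P i) F i t).
Proof.
move=> mF; elim: r => [|i r IH].
  by rewrite (_ : (fun t => _) = fun=> 0); [exact: cL2_cst|apply/funext => t; rewrite big_nil].
have [Pi|Pi] := boolP (P i); last first.
  by move: IH; congr cL2; apply/funext => t; rewrite big_cons (negbTE Pi).
move: (cL2D (mF i) IH); congr cL2.
by apply/funext => t; rewrite big_cons Pi.
Qed.

Lemma cL1D f g : cL1 f -> cL1 g -> cL1 (fun t => f t + g t).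
Proof.
move=> [f1 f2] [g1 g2]; split.
  by under eq_fun do rewrite ReD; exact: integrableD_EFin.
by under eq_fun do rewrite ImD; exact: integrableD_EFin.
Qed.

Lemma cL1Z c f : cL1 f -> cL1 (fun t => c * f t).
Proof.
move=> [f1 f2]; split.
  under eq_fun do rewrite ReM -mulNr.
  by apply: integrableD_EFin; exact: integrableZ_EFin.
under eq_fun do rewrite ImM.
by apply: integrableD_EFin; exact: integrableZ_EFin.
Qed.

Lemma RintD (g h : X -> R) : mu.-integrable D (EFin \o g) ->
  mu.-integrable D (EFin \o h) -> Rintegral mu D (fun t => g t + h t) =
  Rintegral mu D g + Rintegral mu D h.
Proof. exact: RintegralD. Qed.

Lemma RintZ (k : R) (g : X -> R) : mu.-integrable D (EFin \o g) ->
  Rintegral mu D (fun t => k * g t) = k * Rintegral mu D g.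
Proof. by move=> ig; exact: RintegralZl. Qed.

Lemma cintD f g : cL1 f -> cL1 g -> cint (fun t => f t + g t) = cint f + cint g.
Proof.
move=> [f1 f2] [g1 g2]; apply: complexP; rewrite ?(ReD, ImD) /= -mulrDr -RintD //.
  by congr (_ * _); apply: eq_Rintegral => t _; rewrite ReD.
by congr (_ * _); apply: eq_Rintegral => t _; rewrite ImD.
Qed.

Lemma cintZ c f : cL1 f -> cint (fun t => c * f t) = c * cint f.
Proof.
move=> [f1 f2]; apply: complexP; rewrite ?(ReM, ImM) /=.
  transitivity (kap * (Rintegral mu D (fun t => complex.Re c * complex.Re (f t) +
      (- complex.Im c) * complex.Im (f t)))).
    by congr (_ * _); apply: eq_Rintegral => t _; rewrite ReM mulNr.
  by rewrite RintD ?RintZ //; [ring|exact: integrableZ_EFin..].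
transitivity (kap * (Rintegral mu D (fun t => complex.Re c * complex.Im (f t) +
    complex.Im c * complex.Re (f t)))).
  by congr (_ * _); apply: eq_Rintegral => t _; rewrite ImM.
by rewrite RintD ?RintZ //; [ring|exact: integrableZ_EFin..].
Qed.

Lemma cintN f : cL1 f -> cint (fun t => - f t) = - cint f.
Proof.
by move=> /(cintZ (-1)); under eq_fun do rewrite mulN1r; rewrite mulN1r.
Qed.

Lemma cL1N f : cL1 f -> cL1 (fun t => - f t).
Proof. by move=> /(cL1Z (-1)); under eq_fun do rewrite mulN1r. Qed.

Lemma cintB f g : cL1 f -> cL1 g -> cint (fun t => f t - g t) = cint f - cint g.
Proof. by move=> Lf Lg; rewrite cintD ?cintN //; exact: cL1N. Qed.

Lemma eq_cint f g : (forall t, f t = g t) -> cint f = cint g.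
Proof. by move=> /funext ->. Qed.

Lemma cint0 : cint (fun=> 0) = 0.
Proof.
by have := cintZ 0 (cL2_cL1 (cL2_cst 0)); rewrite !mul0r.
Qed.

Lemma cL1_sum (I : Type) (r : seq I) (P : pred I) (F : I -> X -> complex R) :
  (forall i, cL1 (F i)) -> cL1 (fun t => \sum_(i <- r | P i) F i t).
Proof.
move=> mF; elim: r => [|i r IH].
  rewrite (_ : (fun t => _) = fun=> 0); first exact/cL2_cL1/cL2_cst.
  by apply/funext => t; rewrite big_nil.
have [Pi|Pi] := boolP (P i); last first.
  by move: IH; congr cL1; apply/funext => t; rewrite big_cons (negbTE Pi).
move: (cL1D (mF i) IH); congr cL1.
by apply/funext => t; rewrite big_cons Pi.
Qed.

Lemma cint_sum (I : Type) (r : seq I) (P : pred I) (F : I -> X -> complex R) :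
  (forall i, cL1 (F i)) -> cint (fun t => \sum_(i <- r | P i) F i t) =
  \sum_(i <- r | P i) cint (F i).
Proof.
move=> mF; elim: r => [|i r IH].
  by under eq_fun do rewrite big_nil; rewrite cint0 big_nil.
under eq_fun do rewrite big_cons; rewrite big_cons; case: ifP => // _.
by rewrite cintD ?IH //; exact: cL1_sum.
Qed.

Lemma cintJ f : cL1 f -> cint (fun t => conjc (f t)) = conjc (cint f).
Proof.
move=> [f1 f2]; apply: complexP; rewrite ?(ReJ, ImJ) /=.
  by congr (_ * _); apply: eq_Rintegral => t _; rewrite ReJ.
rewrite -mulrN -[- Rintegral _ _ _]mulN1r -(RintZ (-1) f2).
by congr (_ * _); apply: eq_Rintegral => t _; rewrite ImJ mulN1r.
Qed.

Lemma sqN_ge0 f : 0 <= sqN f.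
Proof. by rewrite mulr_ge0 // Rintegral_ge0 // => t _; exact: sqm_ge0. Qed.

Lemma sqNZ c f : cL2 f -> sqN (fun t => c * f t) = sqm c * sqN f.
Proof.
move=> [_ if_]; rewrite /sqN mulrCA -(RintZ (sqm c) if_); congr (_ * _).
by apply: eq_Rintegral => t _; rewrite sqmM.
Qed.

Lemma sqN_eq f g : (forall t, sqm (f t) = sqm (g t)) -> sqN f = sqN g.
Proof. by move=> e; congr (_ * _); apply: eq_Rintegral => t _. Qed.

Lemma sqN_J f : sqN (fun t => conjc (f t)) = sqN f.
Proof. by apply: sqN_eq => t; rewrite sqmJ. Qed.

Lemma sqND f g : cL2 f -> cL2 g -> sqN (fun t => f t + g t) =
  sqN f + sqN g + 2 * complex.Re (cint (fun t => f t * conjc (g t))).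
Proof.
move=> Lf Lg; have [Lfg _] := cL1_cL2M Lf (cL2J Lg).
have [_ if_] := Lf; have [_ ig] := Lg.
rewrite /sqN /= -mulrDr mulrCA -mulrDr; congr (_ * _).
rewrite -RintZ // -RintD // -RintD //; last 2 first.
- exact: integrableD_EFin.
- exact: integrableZ_EFin.
by apply: eq_Rintegral => t _; rewrite sqmD.
Qed.

Lemma sqND_le f g : cL2 f -> cL2 g ->
  sqN (fun t => f t + g t) <= 2 * sqN f + 2 * sqN g.
Proof.
move=> Lf Lg; have := sqN_ge0 (fun t => f t + - g t).
rewrite !sqND //; last exact: cL2N.
under [X in complex.Re (cint X)]eq_fun do rewrite conjcN mulrN.
rewrite cintN ?ReN; last exact: cL1_cL2M Lf (cL2J Lg).
rewrite (sqN_eq (f := fun t => - g t) (g := g)); last by move=> t; rewrite sqmN.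
lra.
Qed.

Lemma cauchy_schwarz f g : cL2 f -> cL2 g ->
  sqm (cint (fun t => f t * g t)) <= sqN f * sqN g.
Proof.
move=> Lf Lg; set s := cint _.
(* Expand the squared norm of [f - t * s * conjc g]: a real quadratic in [t] that never becomes
   negative. *)
have key (t : R) : 0 <= sqN f - 2 * t * sqm s + t ^+ 2 * sqm s * sqN g.
  pose c : complex R := - (t%:C%C * s).
  have := sqN_ge0 (fun x => f x + c * conjc (g x)).
  rewrite sqND //; last exact/cL2Z/cL2J.
  rewrite sqNZ ?sqN_J; last exact: cL2J.
  have -> : cint (fun t0 => f t0 * conjc (c * conjc (g t0))) = conjc c * s.
    rewrite -cintZ; last exact: cL1_cL2M.
    by apply: eq_cint => x; rewrite conjcM conjcK; ring.
  have -> : complex.Re (conjc c * s) = - (t * sqm s).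
    by rewrite /c /sqm; case: (s) => x y /=; ring.
  have -> : sqm c = t ^+ 2 * sqm s.
    by rewrite /c sqmN sqmM /sqm /=; ring.
  lra.
have := sqN_ge0 g; rewrite le_eqVlt => /orP[/eqP g0|g0].
  rewrite -g0 mulr0 leNgt; apply/negP => s0.
  (* When [g] has norm 0 the quadratic is affine in [t]; at this [t] it equals [- sqN f - 2], which
     is negative. *)
  have := key ((sqN f + 1) / sqm s); rewrite -g0.
  have -> : sqN f - 2 * ((sqN f + 1) / sqm s) * sqm s +
     ((sqN f + 1) / sqm s) ^+ 2 * sqm s * 0 = - sqN f - 2.
    by field; rewrite lt0r_neq0.
  by have := sqN_ge0 f; lra.
(* The minimizer of the quadratic. *)
have := key (sqN g)^-1.
have -> : sqN f - 2 * (sqN g)^-1 * sqm s + (sqN g)^-1 ^+ 2 * sqm s * sqN g =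
  sqN f - sqm s / sqN g by field; rewrite lt0r_neq0.
by rewrite subr_ge0 ler_pdivrMr.
Qed.

Lemma sqN_pythagoras f g : cL2 f -> cL2 g ->
  cint (fun t => f t * conjc (g t)) = 0 -> sqN f <= sqN (fun t => f t + g t).
Proof.
by move=> Lf Lg fg; rewrite sqND // fg /= mulr0 addr0 lerDl sqN_ge0.
Qed.

End ComplexIntegral.

(** * Fubini's theorem for real-valued integrals on a product of two sets *)

Section FineIntegral.
Context (d : measure_display) (T : measurableType d) (R : realType).
Variables (mu : {measure set T -> \bar R}) (D : set T).
Hypothesis mD : measurable D.

(** Inner integrals of Fubini's theorem may be infinite on a null set; there [fine] yields 0, which
    does not affect the outer integral. *)
Lemma integrable_fine (G : T -> \bar R) : mu.-integrable D G ->
  mu.-integrable D (EFin \o (fun y => fine (G y))).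
Proof.
move=> iG; apply: (le_integrable mD _ _ iG).
  apply/measurable_EFinP; apply: (measurableT_comp (fine_measurable _)) => //.
  exact: measurable_int iG.
by move=> y _ /=; case: (G y) => [r| |] //=; rewrite normr0 leey.
Qed.

Lemma Rintegral_fine (G : T -> \bar R) : mu.-integrable D G ->
  Rintegral mu D (fun y => fine (G y)) = fine (\int[mu]_(y in D) G y)%E.
Proof.
move=> iG; congr fine; apply: ae_eq_integral => //.
- exact: measurable_int (integrable_fine iG).
- exact: measurable_int iG.
- have := integrable_ae mD iG; apply: filterS => y Gfin Dy.
  by rewrite /= fineK // Gfin.
Qed.

End FineIntegral.

(** Integrability on a product amounts to finiteness of either iterated integral of the modulus, and
    the swap exchanges the two. *)
Lemma integrable_prod_swap (d1 d2 : measure_display) (T1 : measurableType d1)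
    (T2 : measurableType d2) (R : realType)
    (m1 : {sigma_finite_measure set T1 -> \bar R})
    (m2 : {sigma_finite_measure set T2 -> \bar R}) (F : T1 * T2 -> \bar R) :
  (m1 \x m2)%E.-integrable setT F ->
  (m2 \x m1)%E.-integrable setT (fun p => F (p.2, p.1)).
Proof.
move=> iF; have mF := measurable_int _ iF.
apply/integrable12ltyP; last by move/(integrable21ltyP m1 m2 mF): iF.
exact: (measurableT_comp mF (@measurable_swap _ _ T2 T1)).
Qed.

Section RealFubini.
Context (d1 d2 : measure_display) (T1 : measurableType d1) (T2 : measurableType d2).
Context (R : realType).
Variables (m1 : {sigma_finite_measure set T1 -> \bar R}).
Variables (m2 : {sigma_finite_measure set T2 -> \bar R}).
Variables (D1 : set T1) (D2 : set T2).
Hypotheses (mD1 : measurable D1) (mD2 : measurable D2).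
Variable f : T1 * T2 -> R.
Hypothesis If : (m1 \x m2)%E.-integrable (D1 `*` D2) (EFin \o f).

(** Extension by zero, to pass from the rectangle to the whole product, where Fubini's theorem is
    stated. *)
Let F := (EFin \o f) \_ (D1 `*` D2).

Let IF : (m1 \x m2)%E.-integrable setT F.
Proof. exact: (proj1 (integrable_mkcond _ (measurableX mD1 mD2))). Qed.

Let F1 y : D2 y -> (fun x => F (x, y)) = (fun x => (f (x, y))%:E) \_ D1.
Proof.
move=> Dy; apply/funext => x; rewrite /F /patch /=.
by rewrite in_setX /= (mem_set Dy) andbT.
Qed.

Let F2 x : D1 x -> (fun y => F (x, y)) = (fun y => (f (x, y))%:E) \_ D2.
Proof.
move=> Dx; apply/funext => y; rewrite /F /patch /=.
by rewrite in_setX /= (mem_set Dx).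
Qed.

Let G1 y := (\int[m1]_(x in D1) (f (x, y))%:E)%E.
Let G2 x := (\int[m2]_(y in D2) (f (x, y))%:E)%E.

Let FG1 : fubini_G m1 F = G1 \_ D2.
Proof.
apply/funext => y; rewrite /fubini_G /patch; case: ifPn => [/set_mem Dy|/negP Dy].
  by rewrite F1 // -integral_mkcond.
rewrite integral0_eq // => x _; rewrite /F /patch in_setX /=.
by case: (y \in D2) Dy => //; rewrite andbF.
Qed.

Let FG2 : fubini_F m2 F = G2 \_ D1.
Proof.
apply/funext => x; rewrite /fubini_F /patch; case: ifPn => [/set_mem Dx|/negP Dx].
  by rewrite F2 // -integral_mkcond.
rewrite integral0_eq // => y _; rewrite /F /patch in_setX /=.
by case: (x \in D1) Dx.
Qed.

Lemma ae_integrable_slice :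
  {ae m2, forall y, D2 y -> m1.-integrable D1 (fun x => (f (x, y))%:E)}.
Proof.
have := ae_integrable2 IF; apply: filterS => y iy Dy.
by apply/integrable_mkcond => //; rewrite -F1.
Qed.

Let IG1 : m2.-integrable D2 G1.
Proof. 
apply/integrable_mkcond => //; rewrite -FG1.
exact: (integrable_fubini_F (integrable_prod_swap IF)).
 Qed.

Let IG2 : m1.-integrable D1 G2.
Proof. by apply/integrable_mkcond => //; rewrite -FG2; exact: integrable_fubini_F. Qed.

Lemma integrable_Rintegral1 : m2.-integrable D2
  (EFin \o (fun y => Rintegral m1 D1 (fun x => f (x, y)))).
Proof. exact: integrable_fine IG1. Qed.

Lemma Rintegral_prod1 : Rintegral (m1 \x m2)%E (D1 `*` D2) f =
  Rintegral m2 D2 (fun y => Rintegral m1 D1 (fun x => f (x, y))).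
Proof.
rewrite [RHS](Rintegral_fine mD2 IG1) /Rintegral; congr fine.
by rewrite integral_mkcond -(integral21_prod_meas1 IF) FG1 -integral_mkcond.
Qed.

Lemma Rintegral_prod2 : Rintegral (m1 \x m2)%E (D1 `*` D2) f =
  Rintegral m1 D1 (fun x => Rintegral m2 D2 (fun y => f (x, y))).
Proof.
rewrite [RHS](Rintegral_fine mD1 IG2) /Rintegral; congr fine.
by rewrite integral_mkcond -(integral12_prod_meas1 IF) FG2 -integral_mkcond.
Qed.

End RealFubini.

(** * Normalized integrals on the circle and the torus *)

Section SquareIntegrals.
Variable R : realType.
Local Notation C := (complex R).
Local Notation RT := (measurableTypeR R).
Local Notation I1 := (@I1 R).
Local Notation I2 := (@I2 R).
Local Notation leb := (@leb R).
Local Notation leb2 := (@leb2 R).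

Definition kap1 : R := (2 * pi)^-1.
Definition kap2 : R := (2 * pi)^-2.

Lemma kap1_gt0 : 0 < kap1.
Proof. by rewrite invr_gt0 mulr_gt0 // pi_gt0. Qed.

Lemma kap2E : kap2 = kap1 * kap1.
Proof. by rewrite /kap2 /kap1 -expr2 exprVn. Qed.

Lemma kap2_gt0 : 0 < kap2.
Proof. by rewrite kap2E mulr_gt0 // kap1_gt0. Qed.

Definition cmeas1 (f : R -> C) := @cmeas _ RT R I1 f.
Definition cmeas2 (F : R * R -> C) := @cmeas _ (RT * RT)%type R I2 F.

Lemma mI1 : measurable (I1 : set RT).
Proof. exact: measurable_itv. Qed.

Lemma mI2 : measurable (I2 : set (RT * RT)).
Proof. by apply: measurableX; exact: mI1. Qed.

Lemma leb_I1 : leb I1 = (2 * pi)%:E.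
Proof.
rewrite /leb /I1 lebesgue_measure_itv /= lte_fin mulr_gt0 ?pi_gt0 //.
by rewrite oppr0 addr0.
Qed.

Lemma finI1 : (leb I1 < +oo)%E.
Proof. by rewrite leb_I1 ltey. Qed.

Lemma finI2 : (leb2 I2 < +oo)%E.
Proof.
rewrite /leb2 /I2 product_measure1E; [|exact: mI1..].
by rewrite [X in (X * X)%E]leb_I1 -EFinM ltey.
Qed.

Definition mean1 (f : R -> C) := cint leb I1 kap1 f.
Definition mean2 (F : R * R -> C) := cint leb2 I2 kap2 F.
Definition L21 (f : R -> C) := cL2 leb I1 f.
Definition L22 (F : R * R -> C) := cL2 leb2 I2 F.
Definition nsq1 (f : R -> C) := sqN leb I1 kap1 f.
Definition nsq2 (F : R * R -> C) := sqN leb2 I2 kap2 F.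

Lemma cint2E (f : R -> R -> C) : cint2 f = mean2 (fun p => f p.1 p.2).
Proof. by []. Qed.

Lemma lt_pinfty_mulr (k : R) (x : \bar R) : 0 < k -> (0 <= x)%E ->
  (k%:E * x < +oo)%E <-> (x < +oo)%E.
Proof.
move=> k0; case: x => [r| |] //= _; first by rewrite -EFinM !ltey.
by rewrite gt0_muley ?lte_fin // ltxx.
Qed.

Lemma integrable_sqmP (d : measure_display) (X : measurableType d)
    (mu : {measure set X -> \bar R}) (D : set X) (f : X -> C) (k : R) :
  measurable D -> 0 < k -> cmeas D f ->
  mu.-integrable D (fun t => (sqm (f t))%:E) <->
  (k%:E * \int[mu]_(t in D) (sqm (f t))%:E < +oo)%E.
Proof.
move=> mD k0 mf; rewrite lt_pinfty_mulr //; last first.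
  by apply: integral_ge0 => t _; rewrite lee_fin sqm_ge0.
have e : (\int[mu]_(t in D) `|(sqm (f t))%:E| = \int[mu]_(t in D) (sqm (f t))%:E)%E.
  by apply: eq_integral => t _; rewrite /= ger0_norm ?sqm_ge0.
split=> [/integrableP[_]|h]; first by rewrite e.
by apply/integrableP; split; [exact/measurable_EFinP/cmeas_sqm|rewrite e].
Qed.

Lemma L2_1P (f : R -> C) : L2_1 f <-> L21 f.
Proof.
split=> [[m1 [m2 h]]|[[m1 m2] h]].
  split; first by split.
  exact/(integrable_sqmP _ mI1 kap1_gt0 (conj m1 m2)).
split => //; split => //.
exact/(integrable_sqmP _ mI1 kap1_gt0 (conj m1 m2)).
Qed.

Lemma L2_2P (f : R -> R -> C) : L2_2 f <-> L22 (fun p => f p.1 p.2).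
Proof.
split=> [[m1 [m2 h]]|[[m1 m2] h]].
  split; first by split.
  exact/(integrable_sqmP _ mI2 kap2_gt0 (conj m1 m2)).
split => //; split => //.
exact/(integrable_sqmP _ mI2 kap2_gt0 (conj m1 m2)).
Qed.

Lemma l2norm2E (f : R -> R -> C) : L2_2 f ->
  l2norm2 f = Num.sqrt (nsq2 (fun p => f p.1 p.2)).
Proof.
move=> /L2_2P[mf if_]; congr Num.sqrt.
by rewrite /sqnorm2 fineM // (integrable_fin_num mI2 if_).
Qed.

Lemma cmeas_fst (f : R -> C) : cmeas1 f -> cmeas2 (fun p => f p.1).
Proof.
move=> [f1 f2]; split.
  by apply: (measurable_comp mI1 _ f1) => //; [move=> _ [p [? ?] <-]|exact: measurable_funTS].
by apply: (measurable_comp mI1 _ f2) => //; [move=> _ [p [? ?] <-]|exact: measurable_funTS].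
Qed.

Lemma cmeas_snd (f : R -> C) : cmeas1 f -> cmeas2 (fun p => f p.2).
Proof.
move=> [f1 f2]; split.
  by apply: (measurable_comp mI1 _ f1) => //; [move=> _ [p [? ?] <-]|exact: measurable_funTS].
by apply: (measurable_comp mI1 _ f2) => //; [move=> _ [p [? ?] <-]|exact: measurable_funTS].
Qed.

Lemma cmeas_swap (F : R * R -> C) : cmeas2 F -> cmeas2 (fun p => F (p.2, p.1)).
Proof.
have sw : measurable_fun (I2 : set (RT * RT)) (fun p : RT * RT => (p.2, p.1)).
  by apply: measurable_funTS; exact: measurable_swap.
move=> [f1 f2]; split.
  by apply: (measurable_comp mI2 _ f1 sw); move=> _ [p [? ?] <-].
by apply: (measurable_comp mI2 _ f2 sw); move=> _ [p [? ?] <-].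
Qed.

(** For nonnegative integrands, with no integrability assumed: this is how square integrability on
    the torus gets proved. *)
Lemma tonelli1 (f : R * R -> R) : (forall p, 0 <= f p) -> @measurable_fun _ _ (RT * RT)%type R I2 f ->
  (\int[leb2]_(p in I2) (f p)%:E = \int[leb]_(y in I1) \int[leb]_(x in I1) (f (x, y))%:E)%E.
Proof.
move=> f0 mf; rewrite integral_mkcond fubini_tonelli2; last 2 first.
- exact/(measurable_restrictT _ mI2)/measurable_EFinP.
- by move=> p; rewrite /patch; case: ifP => // _; rewrite lee_fin.
rewrite [RHS]integral_mkcond; apply: eq_integral => y _.
rewrite /patch; case: ifPn => yI; last first.
  rewrite /fubini_G integral0_eq // => x _; rewrite /I2 in_setX /= (negbTE yI) andbF //.
rewrite /fubini_G [RHS]integral_mkcond; apply: eq_integral => x _.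
by rewrite /patch /I2 in_setX /= yI andbT.
Qed.

Lemma tonelli2 (f : R * R -> R) : (forall p, 0 <= f p) -> @measurable_fun _ _ (RT * RT)%type R I2 f ->
  (\int[leb2]_(p in I2) (f p)%:E = \int[leb]_(x in I1) \int[leb]_(y in I1) (f (x, y))%:E)%E.
Proof.
move=> f0 mf; rewrite integral_mkcond fubini_tonelli1; last 2 first.
- exact/(measurable_restrictT _ mI2)/measurable_EFinP.
- by move=> p; rewrite /patch; case: ifP => // _; rewrite lee_fin.
rewrite [RHS]integral_mkcond; apply: eq_integral => x _.
rewrite /patch; case: ifPn => xI; last first.
  rewrite /fubini_F integral0_eq // => y _; rewrite /I2 in_setX /= (negbTE xI) //.
rewrite /fubini_F [RHS]integral_mkcond; apply: eq_integral => y _.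
by rewrite /patch /I2 in_setX /= xI.
Qed.

Lemma integrable_swap (f : R * R -> R) : leb2.-integrable I2 (EFin \o f) ->
  leb2.-integrable I2 (EFin \o (fun p => f (p.2, p.1))).
Proof.
move=> /integrableP[/measurable_EFinP mf h].
have sw : measurable_fun (I2 : set (RT * RT)) (fun p : RT * RT => (p.2, p.1)).
  by apply: measurable_funTS; exact: measurable_swap.
have mf' : @measurable_fun _ _ (RT * RT)%type R I2 (fun p : RT * RT => f (p.2, p.1)).
  by apply: (measurable_comp mI2 _ mf sw); move=> _ [p [? ?] <-].
apply/integrableP; split; first exact/measurable_EFinP.
rewrite (@tonelli1 (fun p => `|f (p.2, p.1)|)) //; last exact: measurableT_comp.
by rewrite -(@tonelli2 (fun p => `|f p|)) //; exact: measurableT_comp.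
Qed.

Lemma L22_swap (F : R * R -> C) : L22 F -> L22 (fun p => F (p.2, p.1)).
Proof.
move=> [mF iF]; split; first exact: cmeas_swap.
exact: (integrable_swap iF).
Qed.

Lemma Rintegral_swap (f : R * R -> R) : leb2.-integrable I2 (EFin \o f) ->
  Rintegral leb2 I2 (fun p => f (p.2, p.1)) = Rintegral leb2 I2 f.
Proof.
move=> If; rewrite /I2 /leb2 (Rintegral_prod1 mI1 mI1 (integrable_swap If)).
by rewrite (Rintegral_prod2 mI1 mI1 If).
Qed.

Lemma mean2_swap (F : R * R -> C) : cL1 leb2 I2 F -> mean2 (fun p => F (p.2, p.1)) = mean2 F.
Proof.
move=> [F1 F2]; rewrite /mean2 /cint.
by rewrite (Rintegral_swap F1) (Rintegral_swap F2).
Qed.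

Lemma ae_cL1_slice (F : R * R -> C) : cL1 leb2 I2 F ->
  {ae leb, forall y, I1 y -> cL1 leb I1 (fun x => F (x, y))}.
Proof.
move=> [F1 F2]; have := ae_integrable_slice mI1 mI1 F1.
have := ae_integrable_slice mI1 mI1 F2.
by apply: filterS2 => y h2 h1 yI; split; [exact: h1|exact: h2].
Qed.

Lemma cL1_inner (F : R * R -> C) : cL1 leb2 I2 F ->
  cL1 leb I1 (fun y => mean1 (fun x => F (x, y))).
Proof.
move=> [F1 F2]; split.
  exact: (integrableZ_EFin mI1 kap1 (integrable_Rintegral1 mI1 mI1 F1)).
exact: (integrableZ_EFin mI1 kap1 (integrable_Rintegral1 mI1 mI1 F2)).
Qed.

Lemma fubini_mean (F : R * R -> C) : cL1 leb2 I2 F ->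
  mean2 F = mean1 (fun y => mean1 (fun x => F (x, y))).
Proof.
move=> [F1 F2]; rewrite /mean2 /mean1 /cint; congr Complex => /=.
  rewrite RintegralZl //; [|exact: mI1|exact: (integrable_Rintegral1 mI1 mI1 F1)].
  by rewrite mulrA -kap2E -(Rintegral_prod1 mI1 mI1 F1).
rewrite RintegralZl //; [|exact: mI1|exact: (integrable_Rintegral1 mI1 mI1 F2)].
by rewrite mulrA -kap2E -(Rintegral_prod1 mI1 mI1 F2).
Qed.

Lemma ae_eq_mean1 (f g : R -> C) : cL1 leb I1 f -> cL1 leb I1 g ->
  {ae leb, forall t, I1 t -> f t = g t} -> mean1 f = mean1 g.
Proof.
move=> [f1 f2] [g1 g2]; rewrite /leb => fg; rewrite /mean1 /cint.
congr Complex; congr (_ * fine _); apply: ae_eq_integral.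
- exact: mI1.
- exact: measurable_int f1.
- exact: measurable_int g1.
- by move: fg; apply: (@filterS _ _ (ae_filter_ringOfSetsType lebesgue_measure)) => t e /e ->.
- exact: mI1.
- exact: measurable_int f2.
- exact: measurable_int g2.
- by move: fg; apply: (@filterS _ _ (ae_filter_ringOfSetsType lebesgue_measure)) => t e /e ->.
Qed.

Lemma L22_fst (f : R -> C) : L21 f -> L22 (fun p => f p.1).
Proof.
move=> [mf if_]; have m2 := cmeas_fst mf; split => //.
apply/(integrable_sqmP _ mI2 (@ltr01 R) m2); rewrite mul1e.
rewrite (@tonelli1 (fun p => sqm (f p.1))); [|by move=> p; exact: sqm_ge0|exact: cmeas_sqm].
have /integrableP[_ h] := if_.
rewrite (eq_integral (cst (\int[leb]_(x in I1) (sqm (f x))%:E)%E)) //.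
rewrite integral_cst; last exact: mI1.
have fi := integrable_fin_num mI1 if_.
rewrite [X in (_ * X)%E](_ : _ = (2 * pi)%:E); last exact: leb_I1.
by rewrite ltey_eq (fin_numM fi).
Qed.

Lemma L22_snd (f : R -> C) : L21 f -> L22 (fun p => f p.2).
Proof. by move=> /L22_fst/L22_swap. Qed.

Lemma mean1_cst (c : C) : mean1 (fun=> c) = c.
Proof.
have pi0 : (2 * pi : R) != 0 by rewrite mulf_neq0 // gt_eqF // pi_gt0.
have e (k : R) : kap1 * Rintegral leb I1 (fun=> k) = k.
  rewrite Rintegral_cst; last exact: mI1.
  rewrite [fine _](_ : _ = 2 * pi); last by rewrite [X in fine X]leb_I1.
  by rewrite /kap1 mulrCA mulVf // mulr1.
by case: c => a b; rewrite /mean1 /cint /= !e.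
Qed.

End SquareIntegrals.

(** * The exponential on the circle, and geometric decay *)

Section UnitCircle.
Variable R : realType.
Local Notation C := (complex R).
Local Notation RT := (measurableTypeR R).

Lemma ei0 : ei (0 : R) = 1.
Proof. by apply: complexP; rewrite /= ?cos0 ?sin0. Qed.

Lemma eiD (a b : R) : ei (a + b) = ei a * ei b.
Proof. by apply: complexP; rewrite ?(ReM, ImM) /= ?cosD ?sinD //; ring. Qed.

Lemma eiN (a : R) : ei (- a) = conjc (ei a).
Proof. by apply: complexP; rewrite /= ?cosN ?sinN. Qed.

Lemma sqm_ei (a : R) : sqm (ei a) = 1.
Proof. by rewrite /sqm /= cos2Dsin2. Qed.

Lemma ei_natM k (t : R) : ei (k%:R * t) = ei t ^+ k.
Proof.
elim: k => [|k IH]; first by rewrite mul0r ei0 expr0.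
by rewrite -natr1 mulrDl mul1r eiD IH exprSr.
Qed.

Lemma cmeas_ei : cmeas1 (@ei R).
Proof.
split; apply: measurable_funTS; apply: continuous_measurable_fun.
  exact: continuous_cos.
exact: continuous_sin.
Qed.

End UnitCircle.

Section GeometricDecay.
Variable R : realType.

(** Applied to squared moduli that shrink by the factor [q] at each step of a recursion while
    staying below a common bound. *)
Lemma le0_geometric (a b q : R) : 0 <= q < 1 ->
  (forall k, a <= q ^+ k * b) -> a <= 0.
Proof.
move=> /andP[q0 q1] h.
have cq : (fun k => q ^+ k * b) @ \oo --> (0 : R).
  rewrite -(mul0r b); apply: cvgM; last exact: cvg_cst.
  by apply: cvg_expr; rewrite ger0_norm.
have := cvg_lim (@Rhausdorff R) cq => <-.
apply: limr_ge; first by apply/cvg_ex; exists 0.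
by apply: nearW.
Qed.

End GeometricDecay.

(** * The Cauchy kernel against functions with one-sided spectrum *)

Section CauchyKernel.
Context (d : measure_display) (X : measurableType d) (R : realType).
Variables (mu : {measure set X -> \bar R}) (D : set X) (kap : R).
Hypotheses (mD : measurable D) (kap0 : 0 <= kap) (finD : (mu D < +oo)%E).
Variable E : X -> complex R.
Hypotheses (mE : cmeas D E) (E1 : forall t, sqm (E t) = 1).
Variable z : complex R.
Hypothesis z1 : cabs z < 1.

(** The Cauchy kernel at [z]. The unimodular [E] is later the coordinate of the circle, its
    conjugate, or either coordinate of the torus. *)
Definition ck t : complex R := (1 - z * conjc (E t))^-1.

Lemma mul_conjE t : E t * conjc (E t) = 1.
Proof. by rewrite mul_conjc E1. Qed.

Lemma sqm_ck_den t : (1 - cabs z) ^+ 2 <= sqm (1 - z * conjc (E t)).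
Proof.
set w := z * _; have w2 : sqm w = cabs z ^+ 2.
  by rewrite /w sqmM sqmJ E1 mulr1 sqm_cabs.
have c0 : 0 <= cabs z by exact: sqrtr_ge0.
have Rew : complex.Re w <= cabs z.
  apply: le_trans (ler_norm _) _; rewrite -(ler_pXn2r (n := 2)) ?nnegrE //.
  by rewrite -w2 /sqm real_normK ?num_real // lerDl sqr_ge0.
apply: (@le_trans _ _ ((1 - complex.Re w) ^+ 2)).
  by rewrite ler_sqr ?nnegrE ?subr_ge0 ?(ltW z1) ?(le_trans Rew (ltW z1)) // lerD2l lerN2.
by rewrite /sqm ReD ReN /= lerDl sqr_ge0.
Qed.

Lemma ck_den_neq0 t : 1 - z * conjc (E t) != 0.
Proof.
apply/eqP => e; have := sqm_ck_den t; rewrite e sqm0 leNgt.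
by rewrite exprn_gt0 // subr_gt0.
Qed.

Lemma ck_bound t : sqm (ck t) <= ((1 - cabs z) ^+ 2)^-1.
Proof.
rewrite /ck sqmV lef_pV2 ?posrE ?sqm_ck_den ?exprn_gt0 ?subr_gt0 //.
by apply: lt_le_trans (sqm_ck_den t); rewrite exprn_gt0 // subr_gt0.
Qed.

(** The geometric series of the kernel, unfolded by one term. *)
Lemma ckE t : ck t = 1 + z * conjc (E t) * ck t.
Proof. by have := ck_den_neq0 t; rewrite /ck => h; field. Qed.

Lemma cmeas_ck : cmeas D ck.
Proof.
apply: cmeasV; apply: cmeasB; first exact: cmeas_cst.
by apply: cmeasM; [exact: cmeas_cst|exact: cmeasJ].
Qed.

Lemma cL2_ck F : cL2 mu D F -> cL2 mu D (fun t => F t * ck t).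
Proof.
move=> LF; have := cL2Ml mD cmeas_ck (fun t _ => ck_bound t) LF.
by congr cL2; apply/funext => t; rewrite mulrC.
Qed.

Lemma cL2_unim F (U : X -> complex R) : cmeas D U -> (forall t, sqm (U t) = 1) ->
  cL2 mu D F -> cL2 mu D (fun t => F t * U t).
Proof.
move=> mU U1 LF; have U1' t : D t -> sqm (U t) <= 1 by rewrite U1.
have := cL2Ml mD mU U1' LF.
by congr cL2; apply/funext => t; rewrite mulrC.
Qed.

Lemma cmeas_exp k (U : X -> complex R) : cmeas D U -> cmeas D (fun t => U t ^+ k).
Proof.
move=> mU; elim: k => [|k IH]; first exact: cmeas_cst.
by under eq_fun do rewrite exprS; exact: cmeasM.
Qed.

Lemma cL2_expE k F : cL2 mu D F -> cL2 mu D (fun t => F t * E t ^+ k).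
Proof.
apply: cL2_unim; first exact: cmeas_exp.
by move=> t; rewrite sqmX E1 expr1n.
Qed.

Lemma cL2_expJ k F : cL2 mu D F -> cL2 mu D (fun t => F t * conjc (E t) ^+ k).
Proof.
apply: cL2_unim; first exact/cmeas_exp/cmeasJ.
by move=> t; rewrite sqmX sqmJ E1 expr1n.
Qed.

(* [a k = z * a k.+1] for the bounded sequence [a] of the integrals below *)
Lemma cint_ck_conj F : cL2 mu D F ->
  (forall k, cint mu D kap (fun t => F t * conjc (E t) ^+ k) = 0) ->
  forall k, cint mu D kap (fun t => F t * conjc (E t) ^+ k * ck t) = 0.
Proof.
move=> LF F0; pose a k := cint mu D kap (fun t => F t * conjc (E t) ^+ k * ck t).
have aS k : a k = z * a k.+1.
  rewrite /a -cintZ //; last by apply/(cL2_cL1 mD finD)/cL2_ck/cL2_expJ.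
  rewrite -[RHS]add0r -[X in X + _](F0 k) -cintD //.
  - by apply: eq_cint => t; rewrite [in LHS]ckE exprSr; ring.
  - by apply/(cL2_cL1 mD finD)/cL2_expJ.
  - by apply/cL1Z => //; apply/(cL2_cL1 mD finD)/cL2_ck/cL2_expJ.
pose b := sqN mu D kap F * sqN mu D kap ck.
have Lck : cL2 mu D ck.
  by apply: (cL2_bounded mD finD cmeas_ck) => t _; exact: ck_bound.
have ab k : sqm (a k) <= b.
  apply: le_trans (cauchy_schwarz mD kap0 (cL2_expJ k LF) Lck) _.
  rewrite le_eqVlt; apply/orP; left; apply/eqP; congr (_ * _); apply: sqN_eq => t.
  by rewrite sqmM sqmX sqmJ E1 expr1n mulr1.
have az k j : sqm (a k) = sqm z ^+ j * sqm (a (k + j)%N).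
  elim: j k => [|j IH] k; first by rewrite addn0 expr0 mul1r.
  by rewrite aS sqmM IH addSnnS exprS mulrA.
move=> k; apply: sqm_eq0; apply/eqP; rewrite eq_le sqm_ge0 andbT.
apply: (@le0_geometric _ _ b (sqm z)); first by rewrite sqm_ge0 sqm_lt1.
by move=> j; rewrite (az k j) ler_wpM2l // exprn_ge0 // sqm_ge0.
Qed.

(** For [F] analytic in [E] this says that the value of [E ^+ k * F] at [z] is [z ^+ k] times that
    of [F]. In the step to [k.+1], the conjugate produced by [ckE] cancels one factor [E], and the
    leading term is a vanishing coefficient. *)
Lemma cint_ck_exp F : cL2 mu D F ->
  (forall k, (0 < k)%N -> cint mu D kap (fun t => F t * E t ^+ k) = 0) ->
  forall k, cint mu D kap (fun t => F t * E t ^+ k * ck t) =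
    z ^+ k * cint mu D kap (fun t => F t * ck t).
Proof.
move=> LF F0; elim=> [|k IH].
  by rewrite expr0 mul1r; apply: eq_cint => t; rewrite expr0 mulr1.
rewrite exprS -mulrA -IH -cintZ //; last by apply/(cL2_cL1 mD finD)/cL2_ck/cL2_expE.
rewrite -[RHS]add0r -[X in X + _](F0 k.+1) // -cintD //.
- apply: eq_cint => t; rewrite [in LHS]ckE.
  have -> : F t * E t ^+ k.+1 * (1 + z * conjc (E t) * ck t) =
    F t * E t ^+ k.+1 + (E t * conjc (E t)) * (z * (F t * E t ^+ k * ck t)).
    by rewrite exprS; ring.
  by rewrite mul_conjE mul1r.
- by apply/(cL2_cL1 mD finD)/cL2_expE.
- by apply/cL1Z => //; apply/(cL2_cL1 mD finD)/cL2_ck/cL2_expE.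
Qed.

End CauchyKernel.

(** * Integrating out one variable against a bounded weight *)

Section Slices.
Variable R : realType.
Local Notation C := (complex R).
Local Notation RT := (measurableTypeR R).
Local Notation I1 := (@I1 R).
Local Notation I2 := (@I2 R).
Local Notation leb := (@leb R).
Local Notation leb2 := (@leb2 R).
Local Notation mI1 := (@mI1 R).
Local Notation mI2 := (@mI2 R).
Local Notation finI1 := (@finI1 R).
Local Notation finI2 := (@finI2 R).

Lemma kap1_ge0 : 0 <= kap1 R.
Proof. exact/ltW/kap1_gt0. Qed.

Lemma kap2_ge0 : 0 <= kap2 R.
Proof. exact/ltW/kap2_gt0. Qed.

Lemma L21_L1 (f : R -> C) : L21 f -> cL1 leb I1 f.
Proof. exact: cL2_cL1 mI1 finI1 _. Qed.

Lemma L22_L1 (F : R * R -> C) : L22 F -> cL1 leb2 I2 F.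
Proof. exact: cL2_cL1 mI2 finI2 _. Qed.

Lemma mean2_tensor (u v : R -> C) : cL1 leb I1 u -> cL1 leb I1 v ->
  cL1 leb2 I2 (fun p => u p.1 * v p.2) ->
  mean2 (fun p => u p.1 * v p.2) = mean1 u * mean1 v.
Proof.
move=> Lu Lv Luv; rewrite fubini_mean //= /mean1 -[RHS](cintZ _ mI1) //.
apply: eq_cint => y; rewrite -mulrC -[RHS](cintZ _ mI1) //.
by apply: eq_cint => x; rewrite mulrC.
Qed.

Lemma L22_tensor (u v : R -> C) : L21 u -> L21 v -> L22 (fun p => u p.1 * v p.2).
Proof.
move=> [mu iu] [mv iv].
have m2 : cmeas2 (fun p => u p.1 * v p.2).
  by apply: cmeasM; [exact: cmeas_fst|exact: cmeas_snd].
split => //; apply/(integrable_sqmP _ mI2 (@ltr01 R) m2); rewrite mul1e.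
rewrite (@tonelli1 _ (fun p => sqm (u p.1 * v p.2))); last 2 first.
- by move=> p; exact: sqm_ge0.
- exact: cmeas_sqm.
have /integrableP[_ hu] := iu; have /integrableP[_ hv] := iv.
pose A := Rintegral leb I1 (fun x => sqm (u x)).
rewrite (eq_integral (fun y : RT => (A * sqm (v y))%:E)); last first.
  move=> y _; rewrite /= (eq_integral (fun x : RT => (sqm (v y))%:E * (sqm (u x))%:E)%E).
    rewrite integralZl //; last exact: mI1.
    rewrite mulrC EFinM; congr (_ * _)%E.
    by rewrite /A /Rintegral fineK //; exact: (integrable_fin_num mI1 iu).
  by move=> x _; rewrite sqmM mulrC EFinM.
have /integrableP[_] := integrableZ_EFin mI1 A iv.
apply: le_lt_trans; rewrite le_eqVlt; apply/orP; left; apply/eqP.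
apply: eq_integral => y _ /=; rewrite ger0_norm // mulr_ge0 ?sqm_ge0 //.
by apply: Rintegral_ge0 => x _; exact: sqm_ge0.
Qed.

Lemma L21_J (u : R -> C) : L21 u -> L21 (fun t => conjc (u t)).
Proof. exact: cL2J mI1 _. Qed.

Lemma nsq1E (u : R -> C) : nsq1 u = complex.Re (mean1 (fun t => u t * conjc (u t))).
Proof. by congr (_ * _); apply: eq_Rintegral => t _; rewrite mul_conjc. Qed.

Lemma nsq2E (F : R * R -> C) : nsq2 F = complex.Re (mean2 (fun t => F t * conjc (F t))).
Proof. by congr (_ * _); apply: eq_Rintegral => t _; rewrite mul_conjc. Qed.

Lemma nsq2_fst (u : R -> C) : L21 u -> nsq2 (fun p => u p.1) = nsq1 u.
Proof.
move=> Lu; rewrite nsq1E nsq2E; congr complex.Re.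
have L1u : cL1 leb2 I2 (fun p => u p.1 * conjc (u p.1) * 1).
  under eq_fun do rewrite mulr1.
  by apply: (cL1_cL2M mI2); [exact: L22_fst|exact/(cL2J mI2)/L22_fst].
have := @mean2_tensor (fun x => u x * conjc (u x)) (fun=> 1) _ _ L1u.
rewrite mean1_cst mulr1 => <- //.
- by apply: eq_cint => p; rewrite mulr1.
- by apply: (cL1_cL2M mI1) => //; exact: L21_J.
- exact/L21_L1/(cL2_cst mI1 finI1).
Qed.

Variable c : R -> C.
Hypothesis mc : cmeas1 c.
Variable M : R.
Hypothesis cM : forall t, sqm (c t) <= M.

(** With a Cauchy kernel as weight [c], this evaluates the first variable at a point of the disc. *)
Definition slice (F : R * R -> C) y := mean1 (fun x => F (x, y) * c x).

Let L22_c F : L22 F -> L22 (fun p => F p * c p.1).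
Proof.
move=> LF; have := cL2Ml mI2 (cmeas_fst mc) (fun t _ => cM t.1) LF.
by congr cL2; apply/funext => t; rewrite mulrC.
Qed.

Let L21_c : L21 c.
Proof. by apply: (cL2_bounded mI1 finI1 mc) => t _; exact: cM. Qed.

(** Cauchy-Schwarz on almost every line [y = const] bounds the squared slice by a constant times the
    squared norm of [F] on that line, which is integrable in [y] by Fubini. *)
Lemma L21_slice F : L22 F -> L21 (slice F).
Proof.
move=> LF; have LFc := L22_L1 (L22_c LF).
have L1g := cL1_inner LFc; have mg := cL1_meas L1g.
split => //; apply/(integrable_sqmP _ mI1 (@ltr01 R) mg); rewrite mul1e.
pose b := kap1 R * nsq1 c.
have iF := integrable_Rintegral1 mI1 mI1 (proj2 LF).
have ib := integrableZ_EFin mI1 b iF.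
have /integrableP[mb] := ib.
apply: le_lt_trans; apply: ae_ge0_le_integral.
- exact: mI1.
- by move=> y _; rewrite lee_fin sqm_ge0.
- exact/measurable_EFinP/cmeas_sqm.
- by move=> y _; exact: abse_ge0.
- exact: measurableT_comp mb.
have s1 := ae_cL1_slice (L22_L1 LF).
have s2 := ae_integrable_slice mI1 mI1 (proj2 LF).
move: s1 s2; apply: (@filterS2 _ _ (ae_filter_ringOfSetsType lebesgue_measure)).
move=> y s1 s2 yI; rewrite lee_fin; apply: le_trans (ler_norm _).
have Ly : L21 (fun x => F (x, y)) by split; [exact: cL1_meas (s1 yI)|exact: s2].
apply: le_trans (cauchy_schwarz mI1 kap1_ge0 Ly L21_c) _.
by rewrite le_eqVlt; apply/orP; left; apply/eqP; exact: mulrAC.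
Qed.

Lemma mean1_slice F v : L22 F -> L21 v ->
  mean1 (fun y => slice F y * v y) = mean2 (fun p => F p * c p.1 * v p.2).
Proof.
move=> LF Lv; have LFc := L22_c LF.
have L1 : cL1 leb2 I2 (fun p => F p * c p.1 * v p.2).
  by apply: (cL1_cL2M mI2) => //; exact: L22_snd.
rewrite fubini_mean //; apply: ae_eq_mean1.
- by apply: (cL1_cL2M mI1) => //; exact: L21_slice.
- exact: cL1_inner L1.
have := ae_cL1_slice (L22_L1 LFc).
apply: (@filterS _ _ (ae_filter_ringOfSetsType lebesgue_measure)) => y s1 yI.
rewrite mulrC /slice /mean1 -(cintZ _ mI1); last exact: s1.
by apply: eq_cint => x; rewrite mulrC.
Qed.

End Slices.

(** * Trigonometric polynomials and approximation in the mean *)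

Section TrigonometricDensity.
Variable R : realType.
Local Notation C := (complex R).
Local Notation RT := (measurableTypeR R).
Local Notation I1 := (@I1 R).
Local Notation leb := (@leb R).
Local Notation mI1 := (@mI1 R).
Local Notation finI1 := (@finI1 R).

Definition em (m : int) (t : R) : C := ei (m%:~R * t).

Lemma em0 t : em 0 t = 1.
Proof. by rewrite /em mul0r ei0. Qed.

Lemma emD m n t : em (m + n) t = em m t * em n t.
Proof. by rewrite /em intrD mulrDl eiD. Qed.

Lemma emN m t : em (- m) t = conjc (em m t).
Proof. by rewrite /em mulrNz mulNr eiN. Qed.

Lemma em_nat (k : nat) t : em k%:Z t = ei t ^+ k.
Proof. by rewrite /em -pmulrn ei_natM. Qed.

Lemma em_natN (k : nat) t : em (- k%:Z) t = conjc (ei t) ^+ k.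
Proof. by rewrite emN em_nat; elim: k => [|k IH]; rewrite ?conjc_one // !exprS conjcM IH. Qed.

Lemma sqm_em m t : sqm (em m t) = 1.
Proof. exact: sqm_ei. Qed.

Lemma cmeas_em m : cmeas1 (em m).
Proof.
have cl : continuous (fun t : R => m%:~R * t) by exact: mulrl_continuous.
split; apply: measurable_funTS; apply: continuous_measurable_fun => t.
  exact: (continuous_comp (cl t) (@continuous_cos R _)).
exact: (continuous_comp (cl t) (@continuous_sin R _)).
Qed.

Lemma L21_bounded (u : R -> C) (b : R) : cmeas1 u -> (forall t, I1 t -> sqm (u t) <= b) -> L21 u.
Proof. exact: (cL2_bounded mI1 finI1). Qed.

Lemma L21_em m : L21 (em m).
Proof. by apply: (@L21_bounded _ 1 (cmeas_em m)) => t _; rewrite sqm_em. Qed.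

Lemma Rintegral_FTC (f F : R -> R) : continuous f ->
  (forall t : R, is_derive t 1 F (f t)) -> F 0 = F (2 * pi) ->
  Rintegral leb I1 f = 0.
Proof.
move=> cf dF F02; have dFt t : derivable F t 1 by have [] := dF t.
have cF : continuous F.
  by move=> t; apply: differentiable_continuous; apply/derivable1_diffP.
rewrite /Rintegral /Defs.I1 /Defs.leb (@continuous_FTC2 _ f F) //.
- by rewrite F02 subee.
- by rewrite mulr_gt0 // pi_gt0.
- exact: continuous_subspaceT.
- split; [by move=> t _|exact/cvg_at_right_filter/cF|exact/cvg_at_left_filter/cF].
- by move=> t _; rewrite derive1E; have [_ ->] := dF t.
Qed.

Lemma mean1_em m : mean1 (em m) = (m == 0)%:R.
Proof.
have [->|m0] := eqVneq m 0.
  by rewrite (_ : em 0 = fun=> 1) ?mean1_cst //; apply/funext => t; rewrite em0.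
have k0 : (m%:~R : R) != 0 by rewrite intr_eq0.
set k := (m%:~R : R) in k0.
(* The frequency is a nonzero integer, so the primitives take the same value at both ends of the
   interval. *)
have [per_s per_c] : sin (k * (2 * pi)) = 0 /\ cos (k * (2 * pi)) = 1.
  have E : ei (k * (2 * pi)) = (1 : C).
    have e1 (j : nat) : ei (j%:R * (2 * pi)) = (1 : C).
      rewrite ei_natM (_ : ei _ = 1) ?expr1n //.
      by apply: complexP; rewrite /= mulrC mulr_natr ?cos2pi ?sin2pi.
    rewrite /k; case: (m) => j; first by rewrite -pmulrn e1.
    by rewrite NegzE mulrNz mulNr eiN -pmulrn e1 conjc_one.
  by case: E => -> ->.
have c1 : continuous (fun t : R => cos (k * t)).
  by move=> t; apply: (@continuous_comp _ _ _ ( *%R k) cos);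
    [exact: mulrl_continuous|exact: continuous_cos].
have s1 : continuous (fun t : R => sin (k * t)).
  by move=> t; apply: (@continuous_comp _ _ _ ( *%R k) sin);
    [exact: mulrl_continuous|exact: continuous_sin].
have dlin (t : R) : is_derive t 1 (fun t : R => k * t) k.
  have := @is_deriveZ R R^o R^o id k t 1 1 (is_derive_id _ _).
  by rewrite /GRing.scale /= mulr1.
rewrite /mean1 /cint /em /=.
have ds (t : R) : is_derive t 1 (fun t => k^-1 * sin (k * t)) (cos (k * t)).
  have h := @is_derive1_comp _ sin (fun t => k * t) t _ _ (is_derive_sin _) (dlin t).
  have := @is_deriveZ R R^o R^o _ k^-1 t 1 _ h.
  by rewrite /GRing.scale /= mulrCA mulVf // mulr1.
have dc (t : R) : is_derive t 1 (fun t => - k^-1 * cos (k * t)) (sin (k * t)).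
  have h := @is_derive1_comp _ cos (fun t => k * t) t _ _ (is_derive_cos _) (dlin t).
  have := @is_deriveZ R R^o R^o _ (- k^-1) t 1 _ h.
  have e : - k^-1 * (- sin (k * t) * k) = sin (k * t) by field.
  by rewrite /GRing.scale /= e.
have rc := Rintegral_FTC c1 ds; have rs := Rintegral_FTC s1 dc.
rewrite per_s per_c mulr0 sin0 cos0 in rc rs.
by rewrite rc // rs // mulr0.
Qed.

Lemma nsq1_eq (u v : R -> C) : (forall t, sqm (u t) = sqm (v t)) -> nsq1 u = nsq1 v.
Proof. by move=> h; congr (_ * _); apply: eq_Rintegral => t _; exact: h. Qed.

(** Pairs of a frequency and a coefficient. Frequencies may repeat, so that adding two polynomials
    is concatenating their lists. *)
Definition tp (s : seq (int * C)) (t : R) : C := \sum_(p <- s) p.2 * em p.1 t.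

Definition istrig (u : R -> C) := exists s, u = tp s.

Lemma istrig_em m : istrig (em m).
Proof. by exists [:: (m, 1)]; apply/funext => t; rewrite /tp big_seq1 mul1r. Qed.

Lemma istrig_cst c : istrig (fun=> c).
Proof. by exists [:: (0%R, c)]; apply/funext => t; rewrite /tp big_seq1 em0 mulr1. Qed.

Lemma istrigD u v : istrig u -> istrig v -> istrig (fun t => u t + v t).
Proof.
by move=> [s ->] [r ->]; exists (s ++ r); apply/funext => t; rewrite /tp big_cat.
Qed.

Lemma istrigM u v : istrig u -> istrig v -> istrig (fun t => u t * v t).
Proof.
move=> [s ->] [r ->].
exists [seq (p.1 + q.1, p.2 * q.2) | p <- s, q <- r]; apply/funext => t.
rewrite /tp big_allpairs_dep mulr_suml; apply: eq_bigr => p _.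
rewrite mulr_sumr; apply: eq_bigr => q _ /=.
by rewrite emD; ring.
Qed.

Lemma istrigZ c u : istrig u -> istrig (fun t => c * u t).
Proof. exact/istrigM/istrig_cst. Qed.

Lemma istrigX u k : istrig u -> istrig (fun t => u t ^+ k).
Proof.
move=> Tu; elim: k => [|k IH]; first exact: istrig_cst.
by under eq_fun do rewrite exprS; exact: istrigM.
Qed.

Lemma L21_tp s : L21 (tp s).
Proof.
apply: (cL2_sum mI1 finI1 s xpredT) => p.
by apply: (cL2Z mI1); exact: L21_em.
Qed.

Definition trig_approx (u : R -> C) := L21 u /\
  forall e, 0 < e -> exists s, nsq1 (fun t => u t - tp s t) < e.

Lemma trig_approx_istrig u : istrig u -> trig_approx u.
Proof.
move=> [s ->]; split=> [|e e0]; first exact: L21_tp.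
exists s; rewrite (@nsq1_eq _ (fun t => 0 * tp s t)) ?/nsq1 ?sqNZ ?sqm0 ?mul0r //.
- exact: mI1.
- exact: L21_tp.
- by move=> t; rewrite subrr mul0r.
Qed.

Lemma trig_approxD u v : trig_approx u -> trig_approx v ->
  trig_approx (fun t => u t + v t).
Proof.
move=> [Lu au] [Lv av]; split=> [|e e0]; first exact: (cL2D mI1).
(* Errors are squared norms, and [sqND_le] doubles each of the two. *)
have [s hs] := au (e / 4) ltac:(lra); have [r hr] := av (e / 4) ltac:(lra).
exists (s ++ r).
rewrite (@nsq1_eq _ (fun t => (u t - tp s t) + (v t - tp r t))).
  rewrite /nsq1; apply: le_lt_trans (sqND_le mI1 (@kap1_ge0 R) _ _) _.
  - by apply: (cL2B mI1) => //; exact: L21_tp.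
  - by apply: (cL2B mI1) => //; exact: L21_tp.
  by move: hs hr; rewrite /nsq1; lra.
by move=> t; rewrite /tp big_cat /=; congr sqm; ring.
Qed.

Lemma trig_approxZ (c : C) u : trig_approx u -> trig_approx (fun t => c * u t).
Proof.
move=> [Lu au]; split=> [|e e0]; first exact: (cL2Z mI1).
(* The added 1 covers [c = 0]. *)
have k0 : 0 < sqm c + 1 by rewrite ltr_wpDl // sqm_ge0.
have [s hs] := au (e / (sqm c + 1)) (divr_gt0 e0 k0).
have [r er] := istrigZ c (ex_intro _ s erefl : istrig (tp s)).
exists r.
rewrite (@nsq1_eq _ (fun t => c * (u t - tp s t))); last first.
  by move=> t; rewrite -er mulrBr.
rewrite /nsq1 sqNZ; [|exact: mI1|by apply: (cL2B mI1) => //; exact: L21_tp].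
move: hs; rewrite /nsq1 ltr_pdivlMr //.
have := sqN_ge0 leb I1 (@kap1_ge0 R) (fun t => u t - tp s t).
have := sqm_ge0 c; nra.
Qed.

Definition rapprox (f : R -> R) := trig_approx (fun t => (f t)%:C%C).

Lemma rapproxD f g : rapprox f -> rapprox g -> rapprox (fun t => f t + g t).
Proof.
by move=> af ag; have := trig_approxD af ag; congr trig_approx; apply/funext => t; rewrite rmorphD.
Qed.

Lemma rapproxZ k f : rapprox f -> rapprox (fun t => k * f t).
Proof.
by move=> /(trig_approxZ k%:C%C); congr trig_approx; apply/funext => t; rewrite rmorphM.
Qed.

Lemma rapprox_cst k : rapprox (fun=> k).
Proof. exact/trig_approx_istrig/istrig_cst. Qed.

Lemma rapprox_sum (I : Type) (r : seq I) (F : I -> R -> R) :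
  (forall i, rapprox (F i)) -> rapprox (fun t => \sum_(i <- r) F i t).
Proof.
move=> aF; elim: r => [|i r IH].
  rewrite (_ : (fun t => _) = fun=> 0); first exact: rapprox_cst.
  by apply/funext => t; rewrite big_nil.
have := rapproxD (aF i) IH; congr rapprox.
by apply/funext => t; rewrite big_cons.
Qed.

Lemma sqm_real (x : R) : sqm x%:C%C = x ^+ 2.
Proof. by rewrite /sqm /= expr0n /= addr0. Qed.

(** Approximable functions are closed under dominated limits: as [f_ n] and [f] are bounded by [g],
    the squared differences are bounded by [4 * g ^+ 2], and dominated convergence applies to
    them. *)
Lemma rapprox_lim (f_ : nat -> R -> R) (f g : R -> R) :
  (forall n, rapprox (f_ n)) -> @measurable_fun _ _ RT R I1 f ->
  leb.-integrable I1 (EFin \o (fun t => g t ^+ 2)) ->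
  (forall n t, I1 t -> `|f_ n t| <= g t) ->
  (forall t, I1 t -> `|f t| <= g t) ->
  {ae lebesgue_measure, forall t : RT, I1 t -> (f_ ^~ t) @ \oo --> f t} ->
  rapprox f.
Proof.
move=> af mf ig bf_ bf cv.
have mcf : cmeas1 (fun t => (f t)%:C%C) by split => //; exact: measurable_cst.
have Lf : L21 (fun t => (f t)%:C%C).
  apply: (cL2_dom mI1 mcf ig) => t It; rewrite sqm_real -real_normK ?num_real //.
  by rewrite lerXn2r ?nnegrE // ?bf // (le_trans _ (bf _ It)).
have Ln n : L21 (fun t => (f_ n t)%:C%C) by have [] := af n.
split => // e e0.
pose h n t := sqm ((f_ n t)%:C%C - (f t)%:C%C).
have hE n t : h n t = (f_ n t - f t) ^+ 2 by rewrite /h -rmorphB /= sqm_real.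
have Lh n : L21 (fun t => (f_ n t)%:C%C - (f t)%:C%C) by exact: (cL2B mI1 (Ln n) Lf).
have [] := @dominated_convergence _ RT R lebesgue_measure I1 mI1
  (fun n t => (h n t)%:E) (cst 0%E) (fun t => (4 * g t ^+ 2)%:E).
- by move=> n; exact: measurable_int (proj2 (Lh n)).
- exact: measurable_cst.
- move: cv; apply: (@filterS _ _ (ae_filter_ringOfSetsType lebesgue_measure)) => t ct It.
  apply: (@cvg_EFin R nat \oo _ (fun n => (h n t)%:E) 0); first exact: nearW.
  rewrite (_ : fine \o _ = fun n => (f_ n t - f t) * (f_ n t - f t)); last first.
    by apply/funext => n /=; rewrite hE expr2.
  have c0 : (fun n => f_ n t - f t) @ \oo --> (0 : R).
    by rewrite -(subrr (f t)); apply: cvgB; [exact: ct|exact: cvg_cst].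
  by rewrite -[X in _ --> X](mulr0 (0 : R)); exact: (cvgM c0 c0).
- exact: (integrableZ_EFin mI1 4 ig).
- apply: nearW => t n It; rewrite /= ger0_norm ?sqm_ge0 // lee_fin hE.
  have := bf_ n t It; have := bf t It; rewrite !ler_norml => /andP[? ?] /andP[? ?].
  by nra.
move=> _ + _; under eq_fun do under eq_fun do rewrite sube0.
move=> c0.
have k0 := @kap1_gt0 R.
(* After the normalization by [kap1] this leaves [e / 4] for the distance from [f_ N] to [f];
   another [e / 4] goes to the polynomial approximating [f_ N]. *)
have ek0 : 0 < e / (4 * kap1 R) by rewrite divr_gt0 // mulr_gt0.
have h0 := @fine_cvg R nat \oo _ _ 0 c0.
have [N _ /(_ N (leqnn N))] := (proj1 (@cvgrPdist_lt _ _ _ _ _ _ _) (h0 _)) _ ek0.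
rewrite /= sub0r normrN => hN.
have hN' : nsq1 (fun t => (f_ N t)%:C%C - (f t)%:C%C) < e / 4.
  rewrite /nsq1 /sqN mulrC -ltr_pdivlMr //.
  rewrite (_ : e / 4 / kap1 R = e / (4 * kap1 R)); last by field; rewrite lt0r_neq0.
  apply: le_lt_trans hN; apply: le_trans (ler_norm _).
  rewrite le_eqVlt; apply/orP; left; apply/eqP; congr fine.
  by apply: eq_integral => t _; rewrite ger0_norm // sqm_ge0.
have [s hs] := proj2 (af N) (e / 4) ltac:(lra).
exists s.
rewrite (@nsq1_eq _
  (fun t => ((f_ N t)%:C%C - tp s t) + (- 1) * ((f_ N t)%:C%C - (f t)%:C%C))).
  rewrite /nsq1; apply: le_lt_trans (sqND_le mI1 (@kap1_ge0 R) _ _) _.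
  - exact: (cL2B mI1 (Ln N) (@L21_tp s)).
  - by apply: (cL2Z mI1); exact: Lh.
  rewrite sqNZ //; [|exact: mI1|exact: Lh].
  by rewrite sqmN sqm1 mul1r; move: hs hN'; rewrite /nsq1; lra.
by move=> t; congr sqm; ring.
Qed.

End TrigonometricDensity.

(** * Polynomials that converge to a step function *)

Section PowerStep.
Variable R : realType.
Implicit Types (x p : R) (m N : nat).

Lemma bernoulli_ge x m : 0 <= x <= 1 -> 1 - m%:R * x <= (1 - x) ^+ m.
Proof.
move=> /andP[x0 x1]; elim: m => [|m IH]; first by rewrite mul0r subr0 expr0.
rewrite exprS; apply: (@le_trans _ _ ((1 - x) * (1 - m%:R * x))); last first.
  by rewrite ler_wpM2l // subr_ge0.
have m0 : 0 <= (m%:R : R) by [].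
rewrite -natr1; have : 0 <= m%:R * x ^+ 2 by rewrite mulr_ge0 // sqr_ge0.
nra.
Qed.

(** Since [(1 - x) ^+ m * (1 + x) ^+ m <= 1], it is enough to bound [m%:R * x] by [(1 + x) ^+ m]. *)
Lemma bernoulli_le x m : 0 <= x <= 1 -> (1 - x) ^+ m * (m%:R * x) <= 1.
Proof.
move=> /andP[x0 x1].
have h : m%:R * x <= (1 + x) ^+ m.
  elim: m => [|m IH]; first by rewrite mul0r expr0.
  have h1 : 1 <= (1 + x) ^+ m by rewrite exprn_ege1 // lerDl.
  rewrite -natr1 exprS; nra.
apply: (@le_trans _ _ ((1 - x) ^+ m * (1 + x) ^+ m)).
  by rewrite ler_wpM2l // exprn_ge0 // subr_ge0.
rewrite -exprMn exprn_ile1 //; first by nra.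
by have := sqr_ge0 x; nra.
Qed.

(* Tends to 1 for [p < 1/2] and to 0 for [p > 1/2] as [N] grows, staying in [0, 1]. *)
Definition power_step (p : R) N : R := (1 - p ^+ N) ^+ (2 ^ N).

Lemma power_step_itv p N : 0 <= p <= 1 -> 0 <= power_step p N <= 1.
Proof.
move=> /andP[p0 p1].
have [q0 q1] : 0 <= p ^+ N /\ p ^+ N <= 1 by rewrite exprn_ge0 // exprn_ile1.
by rewrite exprn_ge0 ?subr_ge0 // exprn_ile1 ?subr_ge0 // lerBlDr lerDl.
Qed.

(** Bernoulli's inequality turns the exponent [2 ^ N] into a factor, so the distance to 1 is at most
    [(2 * p) ^+ N]; hence the threshold 1/2. *)
Lemma power_step_cvg1 p : 0 <= p < 2^-1 -> power_step p @ \oo --> (1 : R).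
Proof.
move=> /andP[p0 p1].
apply: (@squeeze_cvgr _ _ _ _ (fun N => 1 - (2 * p) ^+ N) (fun=> 1)).
- apply: nearW => N; apply/andP; split; last first.
    by have /andP[//] : 0 <= power_step p N <= 1 by apply: power_step_itv; lra.
  rewrite exprMn -natrX; apply: bernoulli_ge.
  by rewrite exprn_ge0 // exprn_ile1 //; lra.
- rewrite -[X in _ --> X](subr0 1); apply: cvgB; first exact: cvg_cst.
  by apply: cvg_expr; rewrite ger0_norm; lra.
- exact: cvg_cst.
Qed.

(** Beyond the threshold the same product [(2 * p) ^+ N] grows, and its inverse bounds the power
    step from above. *)
Lemma power_step_cvg0 p : 2^-1 < p <= 1 -> power_step p @ \oo --> (0 : R).
Proof.
move=> /andP[p0 p1].
apply: (@squeeze_cvgr _ _ _ _ (fun=> 0) (fun N => ((2 * p)^-1) ^+ N)).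
- apply: nearW => N; apply/andP; split.
    by have /andP[//] : 0 <= power_step p N <= 1 by apply: power_step_itv; lra.
  rewrite exprVn -[X in _ <= X]div1r ler_pdivlMr ?exprn_gt0 //; last by lra.
  rewrite exprMn -natrX; apply: bernoulli_le.
  by rewrite exprn_ge0 ?exprn_ile1 //; lra.
- exact: cvg_cst.
- apply: cvg_expr; rewrite ger0_norm ?invr_ge0; last by lra.
  by rewrite invf_lt1; lra.
Qed.

End PowerStep.

Import HBNNSimple.

(** * Density of trigonometric polynomials in L^2 of the circle *)

Section TrigonometricDensity2.
Variable R : realType.
Local Notation C := (complex R).
Local Notation RT := (measurableTypeR R).
Local Notation I1 := (@I1 R).
Local Notation leb := (@leb R).
Local Notation mI1 := (@mI1 R).
Local Notation finI1 := (@finI1 R).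

Lemma rapprox_lim_bounded (f_ : nat -> R -> R) (f : R -> R) :
  (forall n, rapprox (f_ n)) -> @measurable_fun _ _ RT R I1 f ->
  (forall n t, I1 t -> `|f_ n t| <= 1) ->
  (forall t, I1 t -> `|f t| <= 1) ->
  {ae lebesgue_measure, forall t : RT, I1 t -> (f_ ^~ t) @ \oo --> f t} ->
  rapprox f.
Proof.
move=> af mf b1 b2 cv; apply: (rapprox_lim af mf _ b1 b2 cv).
exact: (integrable_cst_EFin mI1 finI1).
Qed.

Lemma measurable_indic_RT (A : set RT) : measurable A ->
  @measurable_fun _ _ RT R I1 (\1_A : RT -> R).
Proof. by move=> mA; apply: measurable_funTS; exact: measurable_indic. Qed.

Lemma indic_itv (A : set R) (t : R) : `|\1_A t : R| <= 1.
Proof. by rewrite indicE; case: (t \in A); rewrite ?normr1 ?normr0. Qed.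

Lemma rapprox_eq (f g : R -> R) : rapprox f -> @measurable_fun _ _ RT R I1 g ->
  (forall t, I1 t -> `|g t| <= 1) -> (forall t, I1 t -> f t = g t) -> rapprox g.
Proof.
move=> af mg bg fg; apply: (@rapprox_lim_bounded (fun=> f)) => //.
  by move=> n t It; rewrite fg // bg.
by apply: nearW => t It; rewrite fg //; exact: cvg_cst.
Qed.

(* [step_base a] crosses the level 1/2 exactly at the end points of the arc ]a, 2pi[ *)
Definition step_base (a t : R) : R := 2^-1 - (cos (a / 2) - cos (t - a / 2)) / 4.

(** The defining formula shows a trigonometric polynomial of degree 1; this one shows signs. For [a]
    and [t] inside the interval, [sin (t / 2)] is positive and [sin ((t - a) / 2)] has the sign of
    [t - a]. *)
Lemma step_baseE a t :
  step_base a t = 2^-1 - sin ((t - a) / 2) * sin (t / 2) / 2.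
Proof.
rewrite /step_base.
have -> : a / 2 = t / 2 - (t - a) / 2 by field.
have e : t - (t / 2 - (t - a) / 2) = t / 2 + (t - a) / 2 by field.
by rewrite e cosB cosD; field.
Qed.

Lemma step_base_itv a t : 0 <= step_base a t <= 1.
Proof.
rewrite step_baseE.
have /andP[? ?] : -1 <= sin ((t - a) / 2) <= 1 by rewrite sin_geN1 sin_le1.
have /andP[? ?] : -1 <= sin (t / 2) <= 1 by rewrite sin_geN1 sin_le1.
by apply/andP; split; nra.
Qed.

Lemma istrig_step_base a : istrig (fun t => (step_base a t)%:C%C).
Proof.
have -> : (fun t => (step_base a t)%:C%C) = (fun t =>
    (2^-1 - cos (a / 2) / 4)%:C%C + ((ei (- (a / 2)) * (8^-1)%:C%C) * em 1 t
     + (ei (a / 2) * (8^-1)%:C%C) * em (- 1) t)).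
  apply/funext => t; rewrite emN /em mul1r /step_base cosB.
  apply: complexP; rewrite ?(ReD, ImD, ReM, ImM, ReJ, ImJ) /= ?cosN ?sinN.
    by field.
  by field.
apply: istrigD; first exact: istrig_cst.
by apply: istrigD; apply: istrigZ; exact: istrig_em.
Qed.

Lemma rapprox_power_step a N : rapprox (fun t => power_step (step_base a t) N).
Proof.
apply: trig_approx_istrig.
rewrite (_ : (fun t => _) =
  (fun t => (1 + (- 1) * (step_base a t)%:C%C ^+ N) ^+ (2 ^ N))).
  apply: istrigX; apply: istrigD; first exact: istrig_cst.
  apply: istrigZ; apply: istrigX; exact: istrig_step_base.
by apply/funext => t; rewrite /power_step rmorphXn rmorphB rmorphXn mulN1r.
Qed.

Lemma rapprox_ray (a : R) : rapprox (\1_(`]a, +oo[%classic : set R)).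
Proof.
set A : set RT := `]a, +oo[%classic.
have mA : measurable A by exact: measurable_itv.
have mi := measurable_indic_RT mA.
have bi t : I1 t -> `|\1_A t : R| <= 1 by move=> _; exact: indic_itv.
have inA (t : R) : \1_A t = ((a < t)%R)%:R :> R.
  by rewrite indicE /A mem_setE in_itv /= andbT.
have [a0|a0] := ltP a 0.
  apply: (rapprox_eq (rapprox_cst 1) mi bi) => t; rewrite /I1 /= in_itv /= => /andP[t0 _].
  by rewrite inA (lt_le_trans a0).
have [a2|a2] := leP (2 * pi) a.
  apply: (rapprox_eq (rapprox_cst 0) mi bi) => t; rewrite /I1 /= in_itv /= => /andP[_ t0].
  by rewrite inA ltNge (le_trans t0).
apply: (rapprox_lim_bounded (rapprox_power_step a) mi) => //.
  move=> n t _; have /andP[h0 h1] := power_step_itv n (step_base_itv a t).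
  by rewrite ger0_norm.
(* At these three points the base equals 1/2 and neither convergence lemma applies. *)
have neg : lebesgue_measure.-negligible ([set 0; 2 * pi; a] : set RT).
  by apply: negligibleU; first apply: negligibleU; apply/negligibleP => //;
     exact: lebesgue_measure_set1.
case: neg => N [mN N0 sN]; exists N; split => // t /= nt; apply: sN => /=.
apply: contrapT => /not_orP[/not_orP[t0 t2] ta]; apply: nt.
rewrite /I1 /= in_itv /= => /andP[tg tl].
have {}tg : 0 < t by rewrite lt_neqAle tg andbT; apply/eqP => e; apply: t0.
have {}tl : t < 2 * pi by rewrite lt_neqAle tl andbT; apply/eqP.
have st : 0 < sin (t / 2) by apply: sin_gt0_pi; apply/andP; split; lra.
have /andP[b0 b1] := step_base_itv a t.
rewrite inA; have [lt_at|le_ta] := ltP a t.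
  have sa : 0 < sin ((t - a) / 2) by apply: sin_gt0_pi; apply/andP; split; lra.
  apply: power_step_cvg1; rewrite b0 /= step_baseE.
  by have := mulr_gt0 sa st; lra.
have {}le_ta : t < a by rewrite lt_neqAle le_ta andbT; apply/eqP.
have sa : sin ((t - a) / 2) < 0.
  by rewrite -oppr_gt0 -sinN; apply: sin_gt0_pi; apply/andP; split; lra.
apply: power_step_cvg0; rewrite b1 andbT step_baseE.
have : sin ((t - a) / 2) * sin (t / 2) < 0 by rewrite nmulr_rlt0.
lra.
Qed.

(** A monotone class argument: open rays form a generating family stable under intersection, and
    approximability of the indicator passes to complements and to disjoint countable unions. *)
Lemma rapprox_indic (A : set RT) : measurable A -> rapprox (\1_A).
Proof.
(* The Borel sets are generated here by half-open intervals; open rays generate the same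
   sigma-algebra. *)
have mE : <<s (@ocitv R) >> = <<s (@RGenOInfty.G R) >> := RGenOInfty.measurableE R.
move=> mA; have : <<s (@RGenOInfty.G R) >> A by rewrite -mE; exact: mA.
move: {mA} A; apply: (@dynkin_induction _ RT) => //.
- by move=> _ _ [x ->] [y ->]; exists (Num.max x y); apply/seteqP; split=> t /=;
    rewrite !in_itv /= !andbT gt_max; [move=> [-> ->]|move=> /andP[-> ->]].
- have -> : \1_[set: RT] = (fun=> 1 : R) by apply/funext => t; rewrite indicE in_setT.
  exact: rapprox_cst.
- by move=> _ [x ->]; exact: rapprox_ray.
- move=> S mS aS.
  have := rapproxD (rapprox_cst 1) (rapproxZ (-1) aS); congr rapprox.
  apply/funext => t; rewrite !indicE in_setC.
  by case: (t \in S); rewrite ?mulr1 ?mulr0 ?subrr ?addr0.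
- move=> F mF tF aF.
  pose u n (t : R) := \sum_(i < n) (\1_(F i) t : R).
  (* By disjointness at most one [F k] contains [t], so the partial sums stay in [0, 1] and are
     eventually constant in [n]. *)
  have uE n t : (exists2 k, F k t & u n t = (k < n)%N%:R) \/
      (~ (\bigcup_k F k) t /\ u n t = 0).
    have [[k _ Fk]|nF] := pselect ((\bigcup_k F k) t); [left|right].
      exists k => //; rewrite /u; elim: n => [|n IH]; first by rewrite big_ord0.
      rewrite big_ord_recr /= IH indicE ltnS [(k <= n)%N]leq_eqVlt.
      have [kn|kn] := eqVneq k n; first by rewrite -kn ltnn add0r mem_set.
      rewrite memNset ?addr0 // => Fn; move/eqP: kn; apply.
      by apply: tF => //; exists t.
    split => //; rewrite /u big1 // => i _; rewrite indicE memNset // => Fi.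
    by apply: nF; exists i.
  apply: (@rapprox_lim_bounded u).
  + move=> n; have := @rapprox_sum R nat (iota 0 n) (fun i => \1_(F i)) aF.
    congr rapprox; apply/funext => t; rewrite /u.
    by rewrite -[iota 0 n](_ : index_iota 0 n = _) ?big_mkord // /index_iota subn0.
  + by apply: measurable_indic_RT; exact: bigcupT_measurable.
  + move=> n t _; have [[k _ ->]|[_ ->]] := uE n t; rewrite ?normr0 //.
    by case: (k < n)%N; rewrite ?normr1 ?normr0.
  + by move=> t _; exact: indic_itv.
  + apply: nearW => t _; have [[k _ Fk]|nF] := pselect ((\bigcup_k F k) t).
      rewrite indicE mem_set //; last by exists k.
      apply: cvg_near_cst; exists k.+1 => // n /= kn.
      have [[j Fj ->]|[nF _]] := uE n t; last by exfalso; apply: nF; exists k.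
      suff -> : j = k by rewrite kn.
      by apply: tF => //; exists t.
    rewrite indicE memNset //; apply: cvg_near_cst; apply: nearW => n.
    by have [[j Fj _]|[_ ->]] := uE n t; [exfalso; apply: nF; exists j|].
Qed.

(** Simple functions increase to [f], so [f] itself is the dominating function in [rapprox_lim]. *)
Lemma rapprox_ge0 (f : R -> R) : @measurable_fun _ _ RT R I1 f ->
  (forall t, 0 <= f t) -> leb.-integrable I1 (EFin \o (fun t => f t ^+ 2)) -> rapprox f.
Proof.
move=> mf f0 i2.
have mEf : measurable_fun (I1 : set RT) (EFin \o f) by exact/measurable_EFinP.
pose g n : R -> R := nnsfun_approx mI1 mEf n.
have cg t : I1 t -> (g ^~ t) @ \oo --> f t.
  move=> It; have := @cvg_nnsfun_approx _ RT R I1 mI1 (EFin \o f) mEf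
    (fun t _ => f0 t : (0 <= (EFin \o f) t)%E) t It.
  by move/fine_cvg.
have ndg t : {homo (g ^~ t) : n m / (n <= m)%N >-> n <= m}.
  move=> n m nm; have := @nd_nnsfun_approx _ RT R I1 mI1 (EFin \o f) mEf n m nm.
  by move/lefP; apply.
have g0 n t : 0 <= g n t by exact: fun_ge0.
have gf n t : I1 t -> g n t <= f t.
  move=> It; have ct := cg t It; rewrite -(cvg_lim (@Rhausdorff R) ct).
  by apply: nondecreasing_cvgn_le; [exact: ndg|apply/cvg_ex; exists (f t)].
apply: (@rapprox_lim _ g _ f) => //.
- move=> n.
  have := @rapprox_sum R R (finmap.enum_fset (fset_set (range (g n))))
    (fun y t => y * \1_(g n @^-1` [set y]) t).
  have -> : (fun t => \sum_(y <- finmap.enum_fset (fset_set (range (g n))))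
     y * \1_(g n @^-1` [set y]) t) = g n.
    apply/funext => t; rewrite [RHS]fimfunE fsbig_finite //.
  apply => y; apply: rapproxZ; apply: rapprox_indic.
  exact: measurable_sfunP.
- by move=> n t It; rewrite ger0_norm // gf.
- by move=> t It; rewrite ger0_norm.
- by apply: nearW => t It; exact: cg.
Qed.

Lemma rapprox_L2 (f : R -> R) : @measurable_fun _ _ RT R I1 f ->
  leb.-integrable I1 (EFin \o (fun t => f t ^+ 2)) -> rapprox f.
Proof.
move=> mf i2.
have part (h : R -> R) : @measurable_fun _ _ RT R I1 h -> (forall t, h t ^+ 2 = f t ^+ 2) ->
    rapprox (fun t => Num.max (h t) 0).
  move=> mh h2; apply: rapprox_ge0.
  - by apply: measurable_maxr => //; exact: measurable_cst.
  - by move=> t; rewrite le_max lexx orbT.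
  - apply: (le_integrable mI1 _ _ i2).
      apply/measurable_EFinP/measurable_funX; exact: measurable_maxr.
    move=> t _; rewrite /= lee_fin !ger0_norm ?sqr_ge0 // -h2 /Num.max.
    by case: ifP; rewrite ?expr0n /= ?sqr_ge0.
have mNf : @measurable_fun _ _ RT R I1 (fun t => - f t) by exact: measurable_funN.
have := rapproxD (part f mf (fun=> erefl)) (rapproxZ (-1) (part _ mNf (fun t => sqrrN (f t)))).
congr rapprox; apply/funext => t; rewrite /Num.max oppr_lt0.
by case: (ltgtP (f t) 0) => [h|h|->] //=; rewrite ?oppr0; ring.
Qed.

Lemma trig_density (u : R -> C) : L21 u -> trig_approx u.
Proof.
move=> [[m1 m2] i2].
have h (f : R -> R) : @measurable_fun _ _ RT R I1 f -> (forall t, f t ^+ 2 <= sqm (u t)) -> rapprox f.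
  move=> mf fu; apply: rapprox_L2 => //; apply: (le_integrable mI1 _ _ i2).
    exact/measurable_EFinP/measurable_funX.
  by move=> t _; rewrite /= lee_fin !ger0_norm ?sqr_ge0 ?sqm_ge0.
have r1 := h _ m1 (fun t => ltac:(by rewrite /sqm lerDl sqr_ge0)).
have r2 := h _ m2 (fun t => ltac:(by rewrite /sqm lerDr sqr_ge0)).
have := trig_approxD r1 (trig_approxZ (Complex 0 1) r2); congr trig_approx.
by apply/funext => t; apply: complexP; rewrite ?(ReD, ImD, ReM, ImM) /=; ring.
Qed.

End TrigonometricDensity2.

(** * Fourier spectra and the Hardy spaces of the circle and the torus *)

Section HardySpaces.
Variable R : realType.
Local Notation C := (complex R).
Local Notation RT := (measurableTypeR R).
Local Notation I1 := (@I1 R).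
Local Notation I2 := (@I2 R).
Local Notation leb := (@leb R).
Local Notation leb2 := (@leb2 R).
Local Notation mI1 := (@mI1 R).
Local Notation finI1 := (@finI1 R).
Local Notation mI2 := (@mI2 R).
Local Notation finI2 := (@finI2 R).
Local Notation k1 := (@kap1_ge0 R).
Local Notation k2 := (@kap2_ge0 R).
Implicit Types (u v : R -> C) (F G : R * R -> C) (s : seq (int * C)) (t : R).

Lemma eq_mean1 (f g : R -> C) : (forall t, f t = g t) -> mean1 f = mean1 g.
Proof. by move=> /funext ->. Qed.

Lemma eq_mean2 (F G : R * R -> C) : (forall p, F p = G p) -> mean2 F = mean2 G.
Proof. by move=> /funext ->. Qed.

Lemma L21_eq (f g : R -> C) : (forall t, f t = g t) -> L21 f -> L21 g.
Proof. by move=> /funext ->. Qed.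

Lemma L22_eq (F G : R * R -> C) : (forall p, F p = G p) -> L22 F -> L22 G.
Proof. by move=> /funext ->. Qed.

Lemma L22_emfst m F : L22 F -> L22 (fun p => F p * em m p.1).
Proof.
move=> LF; have h : cmeas2 (fun p => em m p.1) := cmeas_fst (@cmeas_em R m).
have h1 (p : RT * RT) : sqm (em m p.1) = 1 by exact: sqm_em.
exact: (@cL2_unim _ _ _ _ _ mI2 F (fun p => em m p.1) h h1 LF).
Qed.

Lemma L22_emsnd m F : L22 F -> L22 (fun p => F p * em m p.2).
Proof.
move=> LF; have h : cmeas2 (fun p => em m p.2) := cmeas_snd (@cmeas_em R m).
have h1 (p : RT * RT) : sqm (em m p.2) = 1 by exact: sqm_em.
exact: (@cL2_unim _ _ _ _ _ mI2 F (fun p => em m p.2) h h1 LF).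
Qed.

Lemma L21_mulem m u : L21 u -> L21 (fun t => u t * em m t).
Proof. by move=> Lu; apply: (cL2_unim mI1 (@cmeas_em R m) _ Lu) => t; exact: sqm_em. Qed.

Lemma mean1M_tp (u : R -> C) s : L21 u ->
  mean1 (fun t => u t * tp s t) = \sum_(p <- s) p.2 * mean1 (fun t => u t * em p.1 t).
Proof.
move=> Lu; have L1 m : cL1 leb I1 (fun t => u t * em m t) by exact/L21_L1/L21_mulem.
transitivity (mean1 (fun t => \sum_(p <- s) p.2 * (u t * em p.1 t))).
  by apply: eq_mean1 => t; rewrite mulr_sumr; apply: eq_bigr => p _; ring.
rewrite /mean1 (cint_sum _ mI1 finI1) => [|p]; last exact/(cL1Z mI1)/L1.
by apply: eq_bigr => p _; rewrite (cintZ _ mI1).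
Qed.

Lemma mean2M_tp (F : R * R -> C) s : L22 F ->
  mean2 (fun p => F p * tp s p.1) =
  \sum_(q <- s) q.2 * mean2 (fun p => F p * em q.1 p.1).
Proof.
move=> LF; have L1 m : cL1 leb2 I2 (fun p => F p * em m p.1) by exact/L22_L1/L22_emfst.
transitivity (mean2 (fun p => \sum_(q <- s) q.2 * (F p * em q.1 p.1))).
  by apply: eq_mean2 => t; rewrite mulr_sumr; apply: eq_bigr => p _; ring.
rewrite /mean2 (cint_sum _ mI2 finI2) => [|p]; last exact/(cL1Z mI2)/L1.
by apply: eq_bigr => p _; rewrite (cintZ _ mI2).
Qed.

Lemma conjc_tp s t : conjc (tp s t) = tp [seq (- p.1, conjc p.2) | p <- s] t.
Proof.
rewrite /tp big_map; elim: s => [|p s IH].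
  by rewrite !big_nil; apply: complexP; rewrite /= ?oppr0.
by rewrite !big_cons conjcD conjcM IH emN.
Qed.

Lemma tp_filter (S : pred int) s t :
  tp s t = tp [seq p <- s | S p.1] t + tp [seq p <- s | ~~ S p.1] t.
Proof. by rewrite /tp !big_filter (bigID (fun p => S p.1)). Qed.

(** Deleting from an approximating polynomial the frequencies outside [S] cannot increase the error:
    the deleted part is orthogonal to [u] and to the part that is kept, so Pythagoras applies. *)
Lemma spectral_approx (S : pred int) (u : R -> C) : L21 u ->
  (forall m, ~~ S m -> mean1 (fun t => u t * em (- m) t) = 0) ->
  forall e, 0 < e -> exists2 s, all (fun p => S p.1) s &
    nsq1 (fun t => u t - tp s t) < e.
Proof.
move=> Lu uS e e0; have [s hs] := proj2 (trig_density Lu) e e0.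
set s1 := [seq p <- s | S p.1]; set s2 := [seq p <- s | ~~ S p.1].
exists s1; first exact: filter_all.
apply: le_lt_trans hs.
have L1 : L21 (fun t => u t - tp s1 t) by apply: (cL2B mI1) => //; exact: L21_tp.
have L2 : L21 (fun t => - tp s2 t) by apply: (cL2N mI1); exact: L21_tp.
apply: (@le_trans _ _ (nsq1 (fun t => (u t - tp s1 t) + - tp s2 t))); last first.
  rewrite le_eqVlt; apply/orP; left; apply/eqP.
  by apply: nsq1_eq => t; rewrite (tp_filter S s t) opprD addrA.
apply: (sqN_pythagoras mI1 k1 L1 L2); rewrite -/(mean1 _).
transitivity (mean1 (fun t => - ((u t - tp s1 t) * tp [seq (- p.1, conjc p.2) | p <- s2] t))).
  by apply: eq_mean1 => t; rewrite conjcN conjc_tp mulrN.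
rewrite /mean1 (cintN _ mI1) -/(mean1 _); last first.
  by apply: (cL1_cL2M mI1) => //; exact: L21_tp.
rewrite mean1M_tp // big_map big_filter big1_seq ?oppr0 //= => p /andP[Sp ps].
have -> : mean1 (fun t => (u t - tp s1 t) * em (- p.1) t) = 0; last by rewrite mulr0.
transitivity (mean1 (fun t => u t * em (- p.1) t - em (- p.1) t * tp s1 t)).
  by apply: eq_mean1 => t; ring.
rewrite /mean1 (cintB _ mI1); last 2 first.
- exact/L21_L1/L21_mulem.
- by apply: (cL1_cL2M mI1); [exact: L21_em|exact: L21_tp].
rewrite -!/(mean1 _) uS // mean1M_tp; last exact: L21_em.
rewrite big_filter big1_seq ?subr0 //= => q /andP[Sq qs].
rewrite (_ : (fun t => _) = em (- p.1 + q.1)); last by apply/funext => t; rewrite emD.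
rewrite mean1_em addrC subr_eq0.
by case: eqP => [qp|_]; rewrite ?mulr0 //; rewrite qp (negbTE Sp) in Sq.
Qed.

(** [F] annihilates every polynomial in [p.1] with frequencies in [S], and these approximate [u];
    Cauchy-Schwarz passes to the limit. The variable [p.2] is inert throughout. *)
Lemma spectral_ortho (S : pred int) (u : R -> C) (F : R * R -> C) : L21 u -> L22 F ->
  (forall m, ~~ S m -> mean1 (fun t => u t * em (- m) t) = 0) ->
  (forall m, S m -> mean2 (fun p => F p * em m p.1) = 0) ->
  mean2 (fun p => F p * u p.1) = 0.
Proof.
move=> Lu LF uS FS; apply: sqm_eq0; apply/eqP; rewrite eq_le sqm_ge0 andbT.
have b0 : 0 <= nsq2 F by exact: (sqN_ge0 leb2 I2 k2 F).
rewrite leNgt; apply/negP => h.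
(* Error for which Cauchy-Schwarz contradicts a nonzero integral; the added 1 covers [F] of norm
   0. *)
have e0 : 0 < sqm (mean2 (fun p => F p * u p.1)) / (nsq2 F + 1).
  by rewrite divr_gt0 // ltr_wpDl.
have [s Ss hs] := spectral_approx Lu uS e0.
have Lus : L21 (fun t => u t - tp s t) by apply: (cL2B mI1) => //; exact: L21_tp.
have e : mean2 (fun p => F p * u p.1) = mean2 (fun p => F p * (u p.1 - tp s p.1)).
  transitivity (mean2 (fun p => F p * (u p.1 - tp s p.1) + F p * tp s p.1)).
    by apply: eq_mean2 => p; ring.
  rewrite /mean2 (cintD _ mI2) -?/(mean2 _); last 2 first.
  - by apply: (cL1_cL2M mI2) => //; exact: (L22_fst Lus).
  - by apply: (cL1_cL2M mI2) => //; exact: (L22_fst (L21_tp s)).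
  rewrite mean2M_tp // big1_seq ?addr0 // => q /= qs.
  by rewrite FS ?mulr0 //; exact: (allP Ss).
have := cauchy_schwarz mI2 k2 LF (L22_fst Lus).
rewrite -[X in sqm X]/(mean2 _) -e -[X in _ <= _ * X]/(nsq2 _) (nsq2_fst Lus) => cs.
have : nsq2 F * nsq1 (fun t => u t - tp s t) < (nsq2 F + 1) * (sqm (mean2 (fun p => F p * u p.1)) / (nsq2 F + 1)).
  apply: (@le_lt_trans _ _ ((nsq2 F + 1) * nsq1 (fun t => u t - tp s t))).
    by apply: ler_wpM2r; [exact: (sqN_ge0 leb I1 k1)|rewrite lerDl].
  by rewrite ltr_pM2l // ltr_wpDl.
rewrite [X in _ < X]mulrC mulfVK; last by rewrite gt_eqF // ltr_wpDl.
by move=> /(le_lt_trans cs); rewrite ltxx.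
Qed.

(* [m] and [n] are opposite to the frequencies: [coef F m n] is the Fourier
   coefficient of [F] at [(- m, - n)]. *)
Definition coef (F : R * R -> C) (m n : int) := mean2 (fun p => F p * em m p.1 * em n p.2).

(** As in [coef], [m] is minus the frequency. *)
Definition h21 (u : R -> C) := L21 u /\
  forall m : int, 0 < m -> mean1 (fun t => u t * em m t) = 0.

Definition h22 (F : R * R -> C) := L22 F /\
  forall m n : int, 0 < m \/ 0 < n -> coef F m n = 0.

Lemma H2_1P u : H2_1 u <-> h21 u.
Proof.
split=> [[/L2_1P Lu cu]|[Lu cu]]; split => //.
- by case=> [[|k]|] // _; exact: (cu k.+1).
- exact/L2_1P.
- by move=> k k0; exact: (cu k%:Z).
Qed.

Lemma H2_2P f : H2_2 f <-> h22 (fun p => f p.1 p.2).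
Proof.
have e m n : cint2 (fun x y => f x y * ei (- (m%:~R * x + n%:~R * y))) =
    coef (fun p => f p.1 p.2) (- m) (- n).
  rewrite cint2E; apply: eq_mean2 => p.
  by rewrite opprD eiD -mulrA /em !mulrNz !mulNr.
split=> [[/L2_2P Lf cf]|[Lf cf]]; split => //.
- by move=> m n mn; rewrite -(opprK m) -(opprK n) -e cf // !oppr_lt0.
- exact/L2_2P.
- by move=> m n mn; rewrite e cf // !oppr_gt0.
Qed.

Lemma coef_L1 F m n : L22 F -> cL1 leb2 I2 (fun p => F p * em m p.1 * em n p.2).
Proof. by move=> LF; apply/L22_L1/L22_emsnd/L22_emfst. Qed.

Lemma h21D u v : h21 u -> h21 v -> h21 (fun t => u t + v t).
Proof.
move=> [Lu cu] [Lv cv]; split=> [|m m0]; first exact: (cL2D mI1).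
transitivity (mean1 (fun t => u t * em m t + v t * em m t)).
  by apply: eq_mean1 => t; ring.
rewrite /mean1 (cintD _ mI1) -?/(mean1 _) ?cu ?cv ?addr0 //; exact/L21_L1/L21_mulem.
Qed.

Lemma h21Z c u : h21 u -> h21 (fun t => c * u t).
Proof.
move=> [Lu cu]; split=> [|m m0]; first exact: (cL2Z mI1).
transitivity (mean1 (fun t => c * (u t * em m t))).
  by apply: eq_mean1 => t; ring.
rewrite /mean1 (cintZ _ mI1) -?/(mean1 _) ?cu ?mulr0 //; exact/L21_L1/L21_mulem.
Qed.

Lemma h22D F G : h22 F -> h22 G -> h22 (fun p => F p + G p).
Proof.
move=> [LF cF] [LG cG]; split=> [|m n mn]; first exact: (cL2D mI2).
transitivity (mean2 (fun p => F p * em m p.1 * em n p.2 + G p * em m p.1 * em n p.2)).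
  by apply: eq_mean2 => p; ring.
rewrite /mean2 (cintD _ mI2) -?/(mean2 _) -?/(coef _ _ _) ?cF ?cG ?addr0 //; exact: coef_L1.
Qed.

Lemma h22Z c F : h22 F -> h22 (fun p => c * F p).
Proof.
move=> [LF cF]; split=> [|m n mn]; first exact: (cL2Z mI2).
transitivity (mean2 (fun p => c * (F p * em m p.1 * em n p.2))).
  by apply: eq_mean2 => p; ring.
rewrite /mean2 (cintZ _ mI2) -?/(mean2 _) -?/(coef _ _ _) ?cF ?mulr0 //; exact: coef_L1.
Qed.

Lemma h22_eq F G : (forall p, F p = G p) -> h22 F -> h22 G.
Proof. by move=> /funext ->. Qed.

Lemma h21_eq u v : (forall t, u t = v t) -> h21 u -> h21 v.
Proof. by move=> /funext ->. Qed.

Lemma h21_1 : h21 (fun=> 1).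
Proof.
split=> [|m m0]; first exact: (cL2_cst mI1 finI1).
rewrite (_ : (fun t => _) = em m); last by apply/funext => t; rewrite mul1r.
by rewrite mean1_em gt_eqF.
Qed.

Lemma h21_cst c : h21 (fun=> c).
Proof. by apply: h21_eq (h21Z c h21_1) => t; rewrite mulr1. Qed.

Lemma h22_cst0 : h22 (fun=> 0).
Proof.
split=> [|m n mn]; first exact: (cL2_cst mI2 finI2).
by rewrite -[RHS](cint0 (mu := leb2) (kap2 R) mI2 finI2); apply: eq_mean2 => p; rewrite !mul0r.
Qed.

Lemma h21_sum (I : Type) (r : seq I) (u : I -> R -> C) : (forall i, h21 (u i)) ->
  h21 (fun t => \sum_(i <- r) u i t).
Proof.
move=> hu; elim: r => [|i r IH].
  by apply: h21_eq (h21_cst 0) => t; rewrite big_nil.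
by apply: h21_eq (h21D (hu i) IH) => t; rewrite big_cons.
Qed.

Lemma h22_sum (I : Type) (r : seq I) (F : I -> R * R -> C) : (forall i, h22 (F i)) ->
  h22 (fun p => \sum_(i <- r) F i p).
Proof.
move=> hF; elim: r => [|i r IH].
  by apply: h22_eq h22_cst0 => t; rewrite big_nil.
by apply: h22_eq (h22D (hF i) IH) => t; rewrite big_cons.
Qed.

Lemma coef_tensor u v m n : L21 u -> L21 v ->
  coef (fun p => u p.1 * v p.2) m n =
  mean1 (fun t => u t * em m t) * mean1 (fun t => v t * em n t).
Proof.
move=> Lu Lv; rewrite -mean2_tensor; last 3 first.
- exact/L21_L1/L21_mulem.
- exact/L21_L1/L21_mulem.
- exact: (L22_L1 (L22_tensor (L21_mulem m Lu) (L21_mulem n Lv))).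
by apply: eq_mean2 => p; ring.
Qed.

Lemma h22_tensor u v : h21 u -> h21 v -> h22 (fun p => u p.1 * v p.2).
Proof.
move=> [Lu cu] [Lv cv]; split=> [|m n mn]; first exact: L22_tensor.
by rewrite coef_tensor //; case: mn => h; [rewrite cu ?mul0r|rewrite cv ?mulr0].
Qed.

(** Lets one-variable facts be read off from two-variable ones, by viewing [u] as constant in the
    second variable. *)
Lemma h21_fst u : L21 u -> h22 (fun p => u p.1) -> h21 u.
Proof.
move=> Lu [_ cu]; split => // m m0.
have L1 : L21 (fun=> 1 : C) by exact: (cL2_cst mI1 finI1).
have := @coef_tensor u (fun=> 1) m 0 Lu L1.
rewrite (_ : mean1 (fun t => 1 * em 0 t) = 1) ?mulr1 => [<-|]; last first.
  by rewrite -[RHS](mean1_cst (1 : C)); apply: eq_mean1 => t; rewrite em0 mulr1.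
by rewrite -[RHS](cu m 0) //; [apply: eq_mean2 => p; rewrite mulr1|left].
Qed.

Lemma h22_fst u : h21 u -> h22 (fun p => u p.1).
Proof. by move=> hu; apply: h22_eq (h22_tensor hu h21_1) => p; rewrite mulr1. Qed.

Lemma h22_swap F : h22 F -> h22 (fun p => F (p.2, p.1)).
Proof.
move=> [LF cF]; split=> [|m n mn]; first exact: L22_swap.
rewrite -[RHS](cF n m); last by case: mn; [right|left].
rewrite /coef -[RHS]mean2_swap; last exact: coef_L1.
by apply: eq_mean2 => p /=; ring.
Qed.

(* The nonnegative spectrum of [G] only shifts the frequencies of [F] outwards. *)
Lemma h22_mul (G : R -> C) F : h21 G -> h22 F -> L22 (fun p => G p.1 * F p) ->
  h22 (fun p => G p.1 * F p).
Proof.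
move=> [LG cG] [LF cF] LGF; split => // m n mn.
transitivity (mean2 (fun p => F p * em m p.1 * em n p.2 * G p.1)).
  by apply: eq_mean2 => p; ring.
have LF' : L22 (fun p => F p * em m p.1 * em n p.2) by exact/L22_emsnd/L22_emfst.
have shift k : mean2 (fun p => F p * em m p.1 * em n p.2 * em k p.1) = coef F (m + k) n.
  by apply: eq_mean2 => p; rewrite emD; ring.
case: mn => h.
  apply: (@spectral_ortho (fun k => 0 <= k)) => // k k0.
    by apply: cG; rewrite oppr_gt0 ltNge.
  by rewrite shift cF //; left; rewrite ltr_pwDl.
apply: (@spectral_ortho xpredT) => // k _.
by rewrite shift cF //; right.
Qed.

End HardySpaces.

(** * Point evaluations and difference quotients in Hardy spaces *)

Section DifferenceQuotients.
Variable R : realType.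
Local Notation C := (complex R).
Local Notation RT := (measurableTypeR R).
Local Notation I1 := (@I1 R).
Local Notation I2 := (@I2 R).
Local Notation leb := (@leb R).
Local Notation leb2 := (@leb2 R).
Local Notation mI1 := (@mI1 R).
Local Notation finI1 := (@finI1 R).
Local Notation mI2 := (@mI2 R).
Local Notation finI2 := (@finI2 R).
Local Notation k1 := (@kap1_ge0 R).
Local Notation k2 := (@kap2_ge0 R).
Implicit Types (u v : R -> C) (F G K : R * R -> C) (t : R) (z w : C).

(** In this form [hval z G] below is convertible to [hext G z]. *)
Definition kern z t : C := (1 - z * conjc (ei t))^-1.

Lemma cmeas_kern z : cmeas1 (kern z).
Proof. exact: (cmeas_ck (@cmeas_ei R)). Qed.

Lemma kern_bound z : cabs z < 1 -> forall t, sqm (kern z t) <= ((1 - cabs z) ^+ 2)^-1.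
Proof. by move=> z1 t; exact: (ck_bound (E := @ei R : RT -> C) (@sqm_ei R) z1). Qed.

Lemma kern_den_neq0 z t : cabs z < 1 -> 1 - z * conjc (ei t) != 0.
Proof. by move=> z1; exact: (ck_den_neq0 (E := @ei R : RT -> C) (@sqm_ei R) z1). Qed.

Lemma ei_conj t : ei t * conjc (ei t) = 1 :> C.
Proof. by rewrite mul_conjc sqm_ei. Qed.

Lemma ei_neq0 t : ei t != 0 :> C.
Proof. by apply/eqP => e; have := sqm_ei t; rewrite e sqm0 => /esym/eqP; rewrite oner_eq0. Qed.

Lemma ei_subE z t : ei t - z = ei t * (1 - z * conjc (ei t)).
Proof. by rewrite mulrBr mulr1 mulrCA ei_conj mulr1. Qed.

Lemma ei_sub_neq0 z t : cabs z < 1 -> ei t - z != 0.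
Proof. by move=> z1; rewrite ei_subE mulf_neq0 ?ei_neq0 ?kern_den_neq0. Qed.

(** The conjugate factor in front makes the spectrum of [1 / (ei t - z)] strictly negative. *)
Lemma inv_ei_sub z t : (ei t - z)^-1 = conjc (ei t) * kern z t.
Proof.
rewrite ei_subE invfM -/(kern z t); congr (_ * _).
by apply: (mulfI (ei_neq0 t)); rewrite divff ?ei_neq0 // ei_conj.
Qed.

Lemma em1 t : em 1 t = ei t.
Proof. by rewrite /em mul1r. Qed.

Lemma emN1 t : em (- 1) t = conjc (ei t).
Proof. by rewrite emN em1. Qed.

Lemma L21_kern z : cabs z < 1 -> L21 (kern z).
Proof. by move=> z1; apply: (L21_bounded (cmeas_kern z)) => t _; exact: kern_bound. Qed.

Lemma L21_mulkern z u : cabs z < 1 -> L21 u -> L21 (fun t => u t * kern z t).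
Proof. by move=> z1 Lu; exact: (cL2_ck mI1 (@cmeas_ei R) (@sqm_ei R) z1 Lu). Qed.

Lemma cmeas_ei_fst : cmeas2 (fun p : R * R => ei p.1).
Proof. exact: (cmeas_fst (@cmeas_ei R)). Qed.

Lemma cmeas_ei_snd : cmeas2 (fun p : R * R => ei p.2).
Proof. exact: (cmeas_snd (@cmeas_ei R)). Qed.

Lemma L22_kern_fst z F : cabs z < 1 -> L22 F -> L22 (fun p => F p * kern z p.1).
Proof.
move=> z1 LF.
exact: (cL2_ck mI2 (E := fun p : RT * RT => ei p.1) cmeas_ei_fst (fun p => sqm_ei p.1) z1 LF).
Qed.

Lemma L22_kern_snd z F : cabs z < 1 -> L22 F -> L22 (fun p => F p * kern z p.2).
Proof.
move=> z1 LF.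
exact: (cL2_ck mI2 (E := fun p : RT * RT => ei p.2) cmeas_ei_snd (fun p => sqm_ei p.2) z1 LF).
Qed.

Lemma L21_div z u : cabs z < 1 -> L21 u -> L21 (fun t => u t / (ei t - z)).
Proof.
move=> z1 Lu; apply: L21_eq (L21_mulkern z1 (L21_mulem (- 1) Lu)) => t.
by rewrite inv_ei_sub emN1 mulrA.
Qed.

Lemma L22_div_fst z F : cabs z < 1 -> L22 F -> L22 (fun p => F p / (ei p.1 - z)).
Proof.
move=> z1 LF; apply: L22_eq (L22_kern_fst z1 (L22_emfst (- 1) LF)) => p.
by rewrite inv_ei_sub emN1 mulrA.
Qed.

Lemma mean2_kern_neg z F : cabs z < 1 -> L22 F ->
  (forall k : nat, mean2 (fun p => F p * em (- k%:Z) p.1) = 0) ->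
  forall k : nat, mean2 (fun p => F p * em (- k%:Z) p.1 * kern z p.1) = 0.
Proof.
move=> z1 LF F0 k.
have F0' j : cint leb2 I2 (kap2 R) (fun p => F p * conjc (ei p.1) ^+ j) = 0.
  by rewrite -[RHS](F0 j); apply: eq_mean2 => p; rewrite em_natN.
rewrite -[RHS](cint_ck_conj (E := fun p : RT * RT => ei p.1) mI2 k2 finI2
  cmeas_ei_fst (fun p => sqm_ei p.1) z1 LF F0' k).
by apply: eq_mean2 => p; rewrite em_natN.
Qed.

Lemma mean2_kern_neg_snd z F : cabs z < 1 -> L22 F ->
  (forall k : nat, mean2 (fun p => F p * em (- k%:Z) p.2) = 0) ->
  forall k : nat, mean2 (fun p => F p * em (- k%:Z) p.2 * kern z p.2) = 0.
Proof.
move=> z1 LF F0 k.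
have F0' j : cint leb2 I2 (kap2 R) (fun p => F p * conjc (ei p.2) ^+ j) = 0.
  by rewrite -[RHS](F0 j); apply: eq_mean2 => p; rewrite em_natN.
rewrite -[RHS](cint_ck_conj (E := fun p : RT * RT => ei p.2) mI2 k2 finI2
  cmeas_ei_snd (fun p => sqm_ei p.2) z1 LF F0' k).
by apply: eq_mean2 => p; rewrite em_natN.
Qed.

Lemma mean2_kern_pos z F : cabs z < 1 -> L22 F ->
  (forall k : nat, (0 < k)%N -> mean2 (fun p => F p * em k%:Z p.1) = 0) ->
  forall k : nat, mean2 (fun p => F p * em k%:Z p.1 * kern z p.1) =
    z ^+ k * mean2 (fun p => F p * kern z p.1).
Proof.
move=> z1 LF F0 k.
have F0' j : (0 < j)%N -> cint leb2 I2 (kap2 R) (fun p => F p * ei p.1 ^+ j) = 0.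
  by move=> j0; rewrite -[RHS](F0 j j0); apply: eq_mean2 => p; rewrite em_nat.
rewrite -[RHS](cint_ck_exp (E := fun p : RT * RT => ei p.1) mI2 finI2
  cmeas_ei_fst (fun p => sqm_ei p.1) z1 LF F0' k).
by apply: eq_mean2 => p; rewrite em_nat.
Qed.

(** By [ckE] the kernel is 1 plus a term all of whose frequencies are strictly negative.
    Consequently [hval] and [xslice] reproduce constants. *)
Lemma mean1_kern z : cabs z < 1 -> mean1 (kern z) = 1.
Proof.
move=> z1; have L1 := L21_em R (- 1).
have z0 j : cint leb I1 (kap1 R) (fun t => em (- 1) t * conjc (ei t) ^+ j) = 0.
  rewrite (_ : (fun t => _) = em (- 1 - j%:Z)); last first.
    by apply/funext => t; rewrite -em_natN emD.
  by rewrite -[cint _ _ _ _]/(mean1 _) mean1_em lt_eqF // ltrBlDr ltr_wpDr.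
have := cint_ck_conj mI1 k1 finI1 (@cmeas_ei R) (@sqm_ei R) z1 L1 z0 0.
rewrite -[cint _ _ _ _]/(mean1 _) => z2.
have -> : kern z = (fun t => 1 + z * (em (- 1) t * conjc (ei t) ^+ 0 * kern z t)).
  apply/funext => t; rewrite emN1 expr0 mulr1 mulrA.
  exact: (ckE (E := @ei R : RT -> C) (@sqm_ei R) z1 t).
have L0 : cL1 leb I1 (fun t => em (- 1) t * conjc (ei t) ^+ 0 * kern z t).
  apply: L21_L1; apply: L21_mulkern => //.
  by apply: L21_eq L1 => t; rewrite expr0 mulr1.
rewrite /mean1 (cintD _ mI1) -?/(mean1 _); last 2 first.
- exact/L21_L1/(cL2_cst mI1 finI1).
- exact: (cL1Z mI1).
by rewrite mean1_cst /mean1 (cintZ _ mI1) // -/(mean1 _) z2 mulr0 addr0.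
Qed.

(* Cauchy integrals: [hval z u] is the value at [z] of the analytic extension of [u],
   [xslice z F] that of [F] in its first variable, [yslice w F] in its second one. *)
Definition hval z u : C := mean1 (fun t => u t * kern z t).
Definition xslice z F y : C := slice (kern z) F y.
Definition swap F : R * R -> C := fun p => F (p.2, p.1).
Definition yslice w F : R -> C := xslice w (swap F).
Definition xquot z F p : C := (F p - xslice z F p.2) / (ei p.1 - z).
Definition yquot w F p : C := xquot w (swap F) (p.2, p.1).
Definition quot z u t : C := (u t - hval z u) / (ei t - z).

Lemma L21_xslice z F : cabs z < 1 -> L22 F -> L21 (xslice z F).
Proof. by move=> z1; exact: (L21_slice (cmeas_kern z) (kern_bound z1)). Qed.

Lemma mean1_xslice z F n : cabs z < 1 -> L22 F ->
  mean1 (fun t => xslice z F t * em n t) = mean2 (fun p => F p * em n p.2 * kern z p.1).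
Proof.
move=> z1 LF; rewrite (mean1_slice (cmeas_kern z) (kern_bound z1) LF (L21_em R n)).
by apply: eq_mean2 => p; ring.
Qed.

Lemma xslice_pos z F n : cabs z < 1 -> h22 F -> 0 < n ->
  mean1 (fun t => xslice z F t * em n t) = 0.
Proof.
move=> z1 [LF cF] n0; rewrite mean1_xslice //.
have LH := L22_emsnd n LF.
have H0 (k : nat) : mean2 (fun p => F p * em n p.2 * em (- k%:Z) p.1) = 0.
  by rewrite -[RHS](cF (- k%:Z) n); [apply: eq_mean2 => p; ring|right].
rewrite -[RHS](mean2_kern_neg z1 LH H0 0).
by apply: eq_mean2 => p; rewrite oppr0 em0 mulr1.
Qed.

Lemma h21_xslice z F : cabs z < 1 -> h22 F -> h21 (xslice z F).
Proof. by move=> z1 hF; split=> [|n]; [exact: L21_xslice (proj1 hF)|exact: xslice_pos]. Qed.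

(** Dividing by [ei p.1 - z] multiplies by a kernel of negative spectrum, which could create
    negative frequencies. By [mean2_kern_pos] their coefficients in the first variable are all
    multiples of one integral, the value of the numerator at [z], and that is 0. *)
Lemma h22_xquot z F : cabs z < 1 -> h22 F -> h22 (xquot z F).
Proof.
move=> z1 hF; have [LF cF] := hF; have Lg := L21_xslice z1 LF.
have LFg : L22 (fun p => F p - xslice z F p.2) by apply: (cL2B mI2) => //; exact: L22_snd.
split=> [|m n mn]; first exact: (L22_div_fst z1 LFg).
pose H p := (F p - xslice z F p.2) * em n p.2.
have LH : L22 H by exact: L22_emsnd.
have HE k : mean2 (fun p => H p * em k p.1) =
    coef F k n - (k == 0)%:R * mean1 (fun t => xslice z F t * em n t).
  transitivity (mean2 (fun p => F p * em k p.1 * em n p.2 -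
      em k p.1 * (xslice z F p.2 * em n p.2))).
    by apply: eq_mean2 => p; rewrite /H; ring.
  have Lt : L22 (fun p => em k p.1 * (xslice z F p.2 * em n p.2)).
    exact: (L22_tensor (L21_em R k) (L21_mulem n Lg)).
  rewrite /mean2 (cintB _ mI2) -?/(mean2 _); [|exact: coef_L1|exact: L22_L1].
  congr (_ - _); rewrite -mean1_em.
  by apply: mean2_tensor; [exact/L21_L1/L21_em|exact/L21_L1/L21_mulem|exact: L22_L1].
(* The numerator vanishes at [z]: as the kernel has mean 1, the subtracted slice has the same Cauchy
   integral as [F]. *)
have HK : mean2 (fun p => H p * kern z p.1) = 0.
  transitivity (mean2 (fun p => F p * em n p.2 * kern z p.1 -
      kern z p.1 * (xslice z F p.2 * em n p.2))).
    by apply: eq_mean2 => p; rewrite /H; ring.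
  have Lt : L22 (fun p => kern z p.1 * (xslice z F p.2 * em n p.2)).
    exact: (L22_tensor (L21_kern z1) (L21_mulem n Lg)).
  rewrite /mean2 (cintB _ mI2) -?/(mean2 _); last 2 first.
  - exact/L22_L1/L22_kern_fst/L22_emsnd.
  - exact: L22_L1.
  apply/eqP; rewrite subr_eq0; apply/eqP.
  rewrite -[LHS](mean1_xslice n z1 LF) -[LHS]mul1r -(mean1_kern z1); apply/esym.
  by apply: mean2_tensor; [exact/L21_L1/L21_kern|exact/L21_L1/L21_mulem|exact: L22_L1].
have -> : coef (xquot z F) m n = mean2 (fun p => H p * em (m - 1) p.1 * kern z p.1).
  by apply: eq_mean2 => p; rewrite /xquot inv_ei_sub /H emD emN1; ring.
have pos (k : nat) : (forall j : nat, (0 < j)%N -> coef F j%:Z n = 0) ->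
    mean2 (fun p => H p * em k%:Z p.1 * kern z p.1) = 0.
  move=> F0; rewrite (mean2_kern_pos z1 LH) ?HK ?mulr0 // => j j0.
  by rewrite HE F0 // eqz_nat eqn0Ngt j0 mul0r subr0.
case: mn => [m0|n0].
  have [k ->] : exists k : nat, m - 1 = k%:Z.
    by case: m m0 => [[|k]|] // _; exists k; rewrite -addn1 PoszD addrK.
  by apply: pos => j j0; apply: cF; left.
(* For [0 < n] all coefficients of [H] in the first variable vanish, so the kernel lemma for either
   sign of [m - 1] applies. *)
case: (m - 1) => k; first by apply: pos => j _; apply: cF; right.
rewrite NegzE; apply: (mean2_kern_neg z1 LH) => j.
by rewrite HE cF ?xslice_pos ?mulr0 ?subr0 //; right.
Qed.

Lemma h21_yslice w F : cabs w < 1 -> h22 F -> h21 (yslice w F).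
Proof. by move=> w1 hF; apply: h21_xslice => //; exact: h22_swap. Qed.

Lemma h22_yquot w F : cabs w < 1 -> h22 F -> h22 (yquot w F).
Proof. by move=> w1 hF; apply: (h22_swap (h22_xquot w1 _)); exact: h22_swap. Qed.

Lemma h21_quot z u : cabs z < 1 -> h21 u -> h21 (quot z u).
Proof.
move=> z1 hu; have [Lu _] := hu; apply: h21_fst.
  by apply: L21_div => //; apply: (cL2B mI1) => //; exact: (cL2_cst mI1 finI1).
exact: (h22_xquot z1 (h22_fst hu)).
Qed.

Lemma h21_shift z u : h21 u -> h21 (fun t => (ei t - z) * u t).
Proof.
move=> hu; apply: (h21_eq (u := fun t => u t * em 1 t + (- z) * u t)).
  by move=> t; rewrite em1; ring.
apply: h21D; last exact: h21Z.
have [Lu cu] := hu; split=> [|m m0]; first exact: L21_mulem.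
rewrite -[RHS](cu (1 + m)); last by rewrite ltr_pwDr.
by apply: eq_mean1 => t; rewrite emD mulrA.
Qed.

Lemma cabsJ z : cabs (conjc z) = cabs z.
Proof. by rewrite !cabsE sqmJ. Qed.

Lemma conj_den_neq0 z t : cabs z < 1 -> 1 - conjc z * ei t != 0.
Proof.
move=> z1; have := kern_den_neq0 t z1; apply: contra_neq => e.
have := congr1 conjc e; rewrite conjcB conjc_one conjcM conjcK => ->.
by apply: complexP; rewrite /= ?oppr0.
Qed.

(** The multiplier is again a Cauchy kernel, at the point [conjc z] and for the conjugate coordinate
    [E], so [cint_ck_conj] applies with the roles of positive and negative powers exchanged. *)
Lemma h21_geometric z u : cabs z < 1 -> h21 u -> h21 (fun t => u t / (1 - conjc z * ei t)).
Proof.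
move=> z1 [Lu cu]; pose E (t : RT) := conjc (ei t).
have mE : cmeas1 E by exact/cmeasJ/cmeas_ei.
have E1 t : sqm (E t) = 1 by rewrite sqmJ sqm_ei.
have z1' : cabs (conjc z) < 1 by rewrite cabsJ.
have ckE' (t : R) : (1 - conjc z * ei t)^-1 = ck E (conjc z) t by rewrite /ck /E conjcK.
split=> [|m m0].
  apply: L21_eq (cL2_ck mI1 mE E1 z1' Lu) => t; by rewrite ckE'.
have u0 j : cint leb I1 (kap1 R) (fun t => u t * em m t * conjc (E t) ^+ j) = 0.
  rewrite -[RHS](cu (m + j%:Z)); last by rewrite ltr_pwDl.
  by apply: eq_mean1 => t; rewrite emD em_nat /E conjcK mulrA.
rewrite -[RHS](cint_ck_conj mI1 k1 finI1 mE E1 z1' (L21_mulem m Lu) u0 0).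
by apply: eq_mean1 => t; rewrite expr0 mulr1 -ckE'; ring.
Qed.

Definition bfactor z t : C := (ei t - z) / (1 - conjc z * ei t).

Lemma h21_bprod n (a : 'I_n -> C) (P : pred 'I_n) u : (forall i, cabs (a i) < 1) ->
  h21 u -> h21 (fun t => \prod_(i < n | P i) bfactor (a i) t * u t).
Proof.
move=> a1 hu; elim: (index_enum _) => [|i r IH].
  by apply: h21_eq hu => t; rewrite big_nil mul1r.
have [Pi|Pi] := boolP (P i); last first.
  by apply: h21_eq IH => t; rewrite big_cons (negbTE Pi).
apply: h21_eq (h21_shift (a i) (h21_geometric (a1 i) IH)) => t.
by rewrite big_cons Pi /bfactor; ring.
Qed.

(* [conjc (b2 (ei y)) * eta_j y] is [(ei y - w)^-1], whose spectrum is negative. *)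
Lemma kernel_perp w (a : R -> C) K : cabs w < 1 -> L21 a -> h22 K ->
  mean2 (fun p => a p.1 / (ei p.2 - w) * conjc (K p)) = 0.
Proof.
move=> w1 La [LK cK].
have LJ : L22 (fun p => conjc (K p)) by exact: (cL2J mI2).
have LK' : L22 (fun p => conjc (K p) * em (- 1) p.2 * kern w p.2).
  by apply: L22_kern_snd => //; exact: L22_emsnd.
transitivity (mean2 (fun p => conjc (K p) * em (- 1) p.2 * kern w p.2 * a p.1)).
  by apply: eq_mean2 => p; rewrite inv_ei_sub emN1; ring.
apply: (@spectral_ortho _ xpredT) => // m _.
have LH : L22 (fun p => conjc (K p) * em m p.1 * em (- 1) p.2).
  by apply: L22_emsnd; exact: L22_emfst.
have H0 (k : nat) : mean2 (fun p => conjc (K p) * em m p.1 * em (- 1) p.2 * em (- k%:Z) p.2) = 0.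
  (* The 1 comes from the conjugate factor in [inv_ei_sub]; it makes the index positive even for
     [k = 0]. *)
  have k0 : 0 < - m \/ 0 < 1 + k%:Z by right; rewrite ltr_pwDl.
  have := cK (- m) (1 + k%:Z) k0; move=> /(congr1 conjc); rewrite /coef /mean2 -(cintJ _ mI2); last exact: coef_L1.
  move=> e; transitivity (conjc 0 : C); last by apply: complexP; rewrite /= ?oppr0.
  rewrite -e; apply: eq_mean2 => p.
  by rewrite !conjcM -!emN opprD opprK emD; ring.
rewrite -[RHS](mean2_kern_neg_snd w1 LH H0 0).
by apply: eq_mean2 => p; rewrite oppr0 em0; ring.
Qed.

End DifferenceQuotients.

(** * Finite Blaschke products with simple zeros *)

Section FiniteBlaschke.
Variable R : realType.
Local Notation C := (complex R).

(** On the circle, up to the constant [lam], the product is [1 / b]. Splitting off the last zero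
    never creates a double pole, as the zeros are distinct. *)
Lemma partial_fractions n (a : 'I_n -> C) : injective a ->
  exists g (r : 'I_n -> C), forall x, (forall i, x != a i) ->
    \prod_(i < n) ((1 - conjc (a i) * x) / (x - a i)) = g + \sum_(i < n) r i / (x - a i).
Proof.
elim: n a => [|n IH] a inj_a.
  by exists 1, (fun=> 0) => x _; rewrite !big_ord0 addr0.
pose l (i : 'I_n) := lift ord_max i.
have inj_l : injective (fun i => a (l i)) by move=> i j /inj_a/lift_inj.
have [g [r gr]] := IH _ inj_l.
set z := a ord_max; pose k := 1 - conjc z * z.
(* Residues obtained from [(1 - conjc z * x) / (x - z) = k / (x - z) - conjc z], after separating
   the poles of [1 / ((x - a) * (x - z))] with the factor [1 / (a - z)]. *)
pose r' (i : 'I_n.+1) := if unlift ord_max i is Some j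
  then r j * (k / (a (l j) - z) - conjc z) else k * (g - \sum_(j < n) r j / (a (l j) - z)).
exists (- conjc z * g), r' => x xa.
have xz : x - z != 0 by rewrite subr_eq0 xa.
have xl i : x - a (l i) != 0 by rewrite subr_eq0 xa.
have lz i : a (l i) - z != 0.
  by rewrite subr_eq0; apply/eqP => /inj_a /eqP; rewrite eq_sym (negbTE (neq_lift _ _)).
have wl (i : 'I_n) : widen_ord (leqnSn n) i = l i by apply: val_inj; rewrite /= /bump leqNgt ltn_ord.
rewrite !big_ord_recr /=.
under eq_bigr do rewrite wl; under [in RHS]eq_bigr do rewrite wl.
rewrite gr // -/z {2}/r' unlift_none.
under [in RHS]eq_bigr do rewrite /r' liftK.
have -> : (1 - conjc z * x) / (x - z) = k / (x - z) - conjc z by rewrite /k; field.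
have e : \sum_(i < n) r i / (x - a (l i)) * (k / (x - z) - conjc z) =
  \sum_(i < n) r i * (k / (a (l i) - z) - conjc z) / (x - a (l i)) -
  (\sum_(i < n) r i / (a (l i) - z)) * (k / (x - z)).
  rewrite mulr_suml -sumrB; apply: eq_bigr => i _.
  by field; rewrite xl lz xz.
by rewrite mulrDl mulr_suml e; field.
Qed.

Variables (n : nat) (lam : C) (a : 'I_n -> C).
Hypothesis ba : is_blaschke_simple lam a.

Let lam1 : cabs lam = 1. Proof. by case: ba. Qed.
Let a1 i : cabs (a i) < 1. Proof. by case: ba => _ []. Qed.
Let inj_a : injective a. Proof. by case: ba => _ []. Qed.

Local Notation b t := (blaschke lam a (ei t)).

Lemma blaschkeE t : b t = lam * \prod_(i < n) bfactor (a i) t.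
Proof. by []. Qed.

Lemma sqm_bfactor z t : cabs z < 1 -> sqm (bfactor z t) = 1 :> R.
Proof.
move=> z1; have d0 := conj_den_neq0 t z1.
have e : ei t - z = ei t * conjc (1 - conjc z * ei t).
  by rewrite conjcB conjcM conjcK conjc_one -ei_subE.
rewrite /bfactor sqmM sqmV e sqmM sqm_ei mul1r sqmJ divff //.
by apply: contra_neq d0; exact: sqm_eq0.
Qed.

Lemma sqm_blaschke t : sqm (b t) = 1.
Proof.
rewrite blaschkeE sqmM sqm_cabs lam1 expr1n mul1r.
elim: (index_enum _) => [|i r IH]; first by rewrite big_nil sqm1.
by rewrite big_cons sqmM IH sqm_bfactor ?mulr1.
Qed.

Lemma blaschke_conj t : b t * conjc (b t) = 1.
Proof. by rewrite mul_conjc sqm_blaschke. Qed.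

Lemma cmeas_blaschke : cmeas1 (fun t => b t).
Proof.
apply: cmeasM; first exact: cmeas_cst.
apply: cmeas_prod => i.
apply: cmeasM; first by apply: cmeasB; [exact: cmeas_ei|exact: cmeas_cst].
apply: cmeasV; apply: cmeasB; first exact: cmeas_cst.
by apply: cmeasM; [exact: cmeas_cst|exact: cmeas_ei].
Qed.

Lemma blaschke_inv : exists g (r : 'I_n -> C),
  forall t, b t * (g + \sum_(i < n) r i / (ei t - a i)) = 1.
Proof.
have [g [r gr]] := partial_fractions inj_a.
exists (conjc lam * g), (fun i => conjc lam * r i) => t.
have -> : conjc lam * g + \sum_(i < n) conjc lam * r i / (ei t - a i) =
    conjc lam * \prod_(i < n) ((1 - conjc (a i) * ei t) / (ei t - a i)).
  rewrite gr => [|i]; last by rewrite -subr_eq0 ei_sub_neq0.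
  by rewrite mulrDr mulr_sumr; congr (_ + _); apply: eq_bigr => i _; rewrite mulrA.
rewrite blaschkeE mulrACA -big_split /= mul_conjc sqm_cabs lam1 expr1n mul1r.
apply: big1 => i _; rewrite /bfactor.
have := conj_den_neq0 t (a1 i); have := ei_sub_neq0 t (a1 i) => h1 h2.
by field; rewrite h1 h2.
Qed.

Lemma h21_blaschke_mul u : h21 u -> h21 (fun t => b t * u t).
Proof.
move=> hu; apply: h21_eq (h21Z lam (h21_bprod xpredT a1 hu)) => t.
by rewrite blaschkeE mulrA.
Qed.

Local Notation X := (xi (blaschke lam a) a).

Lemma h21_xi i : h21 (X i).
Proof.
(* Cancelling the zero [a i] leaves the other Blaschke factors and the denominator of factor [i], a
   geometric multiplier. *)
have := h21Z lam (h21_bprod (predC1 i) a1 (h21_geometric (a1 i) (h21_1 R))).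
apply: h21_eq => t; rewrite /xi blaschkeE [in RHS](bigD1 i) //=.
have := conj_den_neq0 t (a1 i); have := ei_sub_neq0 t (a1 i) => h1 h2.
set P := \prod_(_ < n | _) _; rewrite /bfactor.
by field; rewrite h1 h2.
Qed.

Lemma xi_conj i t : conjc (b t) * X i t = (ei t - a i)^-1.
Proof. by rewrite /xi mulrA [conjc _ * _]mulrC blaschke_conj mul1r. Qed.

End FiniteBlaschke.

(** * Bounded analytic multipliers, orthogonality after division by [B], and nearest points in
    H^2 *)

Section ModelSpace.
Variable R : realType.
Local Notation C := (complex R).
Local Notation RT := (measurableTypeR R).
Local Notation I1 := (@I1 R).
Local Notation I2 := (@I2 R).
Local Notation leb := (@leb R).
Local Notation leb2 := (@leb2 R).
Local Notation mI1 := (@mI1 R).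
Local Notation finI1 := (@finI1 R).
Local Notation mI2 := (@mI2 R).
Local Notation finI2 := (@finI2 R).
Local Notation k2 := (@kap2_ge0 R).
Implicit Types (u v G : R -> C) (F K : R * R -> C) (t : R).

(** [Hinf] bounds a function only almost everywhere, whereas [cL2Ml] asks for a bound at every
    point. *)
Lemma cL2_ae_bounded (d : measure_display) (X : measurableType d)
    (mu : {measure set X -> \bar R}) (D : set X) (M : R) (G F : X -> C) :
  measurable D -> cmeas D G -> {ae mu, forall x, D x -> sqm (G x) <= M} ->
  cL2 mu D F -> cL2 mu D (fun x => G x * F x).
Proof.
move=> mD mG bG [mF iF]; have mGF := cmeasM mG mF.
split => //; apply/(integrable_sqmP _ mD (@ltr01 R) mGF); rewrite mul1e.
have iM := integrableZ_EFin mD M iF; have /integrableP[mM] := iM.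
apply: le_lt_trans; apply: ae_ge0_le_integral => //.
- by move=> t _; rewrite lee_fin sqm_ge0.
- exact/measurable_EFinP/cmeas_sqm.
- exact: measurableT_comp mM.
move: bG; apply: filterS => t bG Dt; rewrite lee_fin; apply: le_trans (ler_norm _).
by rewrite sqmM ler_wpM2r ?sqm_ge0 // bG.
Qed.

Definition bounded_ae G := cmeas1 G /\
  exists M : R, {ae (@lebesgue_measure R), forall t : RT, I1 t -> sqm (G t) <= M}.

Lemma L21_mul_bounded G u : bounded_ae G -> L21 u -> L21 (fun t => G t * u t).
Proof. by move=> [mG [M bG]]; exact: (cL2_ae_bounded mI1 mG bG). Qed.

Lemma L22_mul_bounded G F : bounded_ae G -> L22 F -> L22 (fun p => G p.1 * F p).
Proof.
move=> [mG [M [N [mN N0 sN]]]]; apply: (cL2_ae_bounded (M := M) mI2 (cmeas_fst mG)).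
exists (N `*` setT); split.
- by apply: measurableX => //; exact: measurableT.
(* The strip over a null set is null, even though the line has infinite measure, because
   [0 * +oo = 0]. *)
- apply: etrans (product_measure1E lebesgue_measure lebesgue_measure mN (@measurableT _ RT)) _.
  by apply: etrans (congr1 (fun a => a * _)%E N0) _; exact: mul0e.
move=> p /= np; split => //; apply: sN => /= h; apply: np => -[p1 p2].
exact: h.
Qed.

Lemma HinfP G : Hinf G -> bounded_ae G /\ h21 G.
Proof.
move=> [m1 [m2 [[M bM] cG]]].
have bG : bounded_ae G.
  split; first by split.
  exists (M ^+ 2); move: bM.
  apply: (@filterS _ _ (ae_filter_ringOfSetsType lebesgue_measure)) => t h It.
  have c0 : 0 <= cabs (G t) by exact: sqrtr_ge0.
  by rewrite sqm_cabs lerXn2r ?nnegrE // ?(le_trans c0) // h.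
split => //; apply/H2_1P; split => //; apply/L2_1P.
apply: L21_eq (L21_mul_bounded bG (proj1 (h21_1 R))) => t.
by rewrite mulr1.
Qed.

Lemma h22_mul_Hinf G F : Hinf G -> h22 F -> h22 (fun p => G p.1 * F p).
Proof.
move=> /HinfP[bG hG] hF; apply: h22_mul => //.
exact: L22_mul_bounded (proj1 hF).
Qed.

Lemma h22_mul_Hinf_snd G F : Hinf G -> h22 F -> h22 (fun p => G p.2 * F p).
Proof.
move=> hG hF; have := h22_swap (h22_mul_Hinf hG (h22_swap hF)).
by apply: h22_eq => -[x y].
Qed.

Lemma h21_mul_Hinf G u : Hinf G -> h21 u -> h21 (fun t => G t * u t).
Proof.
move=> hG hu; apply: h21_fst; last exact: (h22_mul_Hinf hG (h22_fst hu)).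
exact: L21_mul_bounded (proj1 (HinfP hG)) (proj1 hu).
Qed.

(* [L^2] functions [F] with [conjc B * F] orthogonal to [H^2], where [B p] stands
   for [b1 (ei p.1) * b2 (ei p.2)]. *)
Definition bperp (B : R * R -> C) F := L22 F /\
  forall K, h22 K -> mean2 (fun p => conjc (B p) * F p * conjc (K p)) = 0.

Section Unimodular.
Variable B : R * R -> C.
Hypotheses (mB : cmeas2 B) (B1 : forall p, sqm (B p) = 1).

Lemma L22_conjB F : L22 F -> L22 (fun p => conjc (B p) * F p).
Proof.
move=> LF; have b1 (p : RT * RT) : I2 p -> sqm (conjc (B p)) <= 1 by rewrite sqmJ B1.
exact: (cL2Ml mI2 (cmeasJ mB) b1 LF).
Qed.

Lemma bperpL1 F K : L22 F -> L22 K -> cL1 leb2 I2 (fun p => conjc (B p) * F p * conjc (K p)).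
Proof. by move=> LF LK; apply: (cL1_cL2M mI2); [exact: L22_conjB|exact: (cL2J mI2)]. Qed.

Lemma bperp_eq F F' : (forall p, F p = F' p) -> bperp B F -> bperp B F'.
Proof. by move=> /funext ->. Qed.

Lemma bperpD F F' : bperp B F -> bperp B F' -> bperp B (fun p => F p + F' p).
Proof.
move=> [LF oF] [LF' oF']; split=> [|K hK]; first exact: (cL2D mI2).
transitivity (mean2 (fun p => conjc (B p) * F p * conjc (K p) +
    conjc (B p) * F' p * conjc (K p))); first by apply: eq_mean2 => p; ring.
have LK := proj1 hK.
rewrite /mean2 (cintD _ mI2) -?/(mean2 _) ?oF ?oF' ?addr0 //; exact: bperpL1.
Qed.

Lemma bperpZ c F : bperp B F -> bperp B (fun p => c * F p).
Proof.
move=> [LF oF]; split=> [|K hK]; first exact: (cL2Z mI2).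
transitivity (mean2 (fun p => c * (conjc (B p) * F p * conjc (K p)))).
  by apply: eq_mean2 => p; ring.
have LK := proj1 hK.
rewrite /mean2 (cintZ _ mI2) -?/(mean2 _) ?oF ?mulr0 //; exact: bperpL1.
Qed.

Lemma bperp_sum (I : Type) (r : seq I) (F : I -> R * R -> C) :
  (forall i, bperp B (F i)) -> bperp B (fun p => \sum_(i <- r) F i p).
Proof.
move=> hF; elim: r => [|i r IH]; last first.
  by apply: bperp_eq (bperpD (hF i) IH) => p; rewrite big_cons.
split=> [|K hK].
  by apply: L22_eq (proj1 (h22_cst0 R)) => p; rewrite big_nil.
transitivity (mean2 (fun=> 0 : C)).
  by apply: eq_mean2 => p; rewrite big_nil mulr0 mul0r.
exact: (cint0 (mu := leb2) _ mI2 finI2).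
Qed.

Lemma nsq2_conjB F : nsq2 (fun p => conjc (B p) * F p) = nsq2 F.
Proof.
by congr (_ * _); apply: eq_Rintegral => p _; rewrite sqmM sqmJ B1 mul1r.
Qed.

End Unimodular.

(** The remainder [g - h] is orthogonal to [h - k], so Pythagoras makes [h] a nearest point to [g]
    in H^2. *)
Lemma proj_min (g h k : R -> R -> C) : L22 (fun p => g p.1 p.2) -> is_projH2 g h ->
  h22 (fun p => k p.1 p.2) ->
  nsq2 (fun p => g p.1 p.2 - h p.1 p.2) <= nsq2 (fun p => g p.1 p.2 - k p.1 p.2).
Proof.
move=> Lg [/H2_2P hh orth] hk.
have hd : h22 (fun p => h p.1 p.2 - k p.1 p.2).
  by apply: h22_eq (h22D hh (h22Z (- 1) hk)) => p; rewrite mulN1r.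
have Lgh : L22 (fun p => g p.1 p.2 - h p.1 p.2) := cL2B mI2 Lg (proj1 hh).
have o := orth (fun x y => h x y - k x y) (proj2 (H2_2P _) hd).
have := sqN_pythagoras mI2 k2 Lgh (proj1 hd) o.
move=> le1; apply: (le_trans le1); rewrite le_eqVlt; apply/orP; left; apply/eqP.
by congr (_ * _); apply: eq_Rintegral => p _; congr sqm; ring.
Qed.

(** Both remainders realize the distance from [g] to H^2; this replaces uniqueness of the
    projection, which would hold only up to null sets. *)
Lemma proj_nsq_unique (g h k : R -> R -> C) : L22 (fun p => g p.1 p.2) ->
  is_projH2 g h -> is_projH2 g k ->
  nsq2 (fun p => g p.1 p.2 - h p.1 p.2) = nsq2 (fun p => g p.1 p.2 - k p.1 p.2).
Proof.
move=> Lg ph pk; apply/eqP; rewrite eq_le !proj_min //.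
  by have [/H2_2P] := ph.
by have [/H2_2P] := pk.
Qed.

End ModelSpace.

(** * Model space elements, the multiplier, and interpolation at the zeros *)

Section MainIdentities.
Variable R : realType.
Local Notation C := (complex R).
Local Notation RT := (measurableTypeR R).
Local Notation mI1 := (@mI1 R).
Local Notation mI2 := (@mI2 R).
Variables (n : nat) (lam1 lam2 : C) (z w : 'I_n -> C).
Hypotheses (bz : is_blaschke_simple lam1 z) (bw : is_blaschke_simple lam2 w).

Local Notation b1 := (blaschke lam1 z).
Local Notation b2 := (blaschke lam2 w).
Local Notation X1 := (xi b1 z).
Local Notation X2 := (xi b2 w).

Let z1 i : cabs (z i) < 1. Proof. by case: bz => _ []. Qed.
Let w1 i : cabs (w i) < 1. Proof. by case: bw => _ []. Qed.

Let B (p : R * R) : C := b1 (ei p.1) * b2 (ei p.2).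

Let mB : cmeas2 B.
Proof.
by apply: cmeasM; [exact: (cmeas_fst (cmeas_blaschke lam1 z))|exact: (cmeas_snd (cmeas_blaschke lam2 w))].
Qed.

Let B1 p : sqm (B p) = 1.
Proof. by rewrite /B sqmM !sqm_blaschke ?mulr1. Qed.

(** Division by [B] turns [X1 i] into [1 / (ei p.1 - z i)], whose negative spectrum gives
    orthogonality whatever the second factor is. So [v] need only be in L^2, and may absorb both
    [conjc b2] and [G2]. The swap is there because [kernel_perp] is stated for a kernel in the
    second variable. *)
Lemma bperp_xi i (v : R -> C) : L21 v -> bperp B (fun p => X1 i p.1 * v p.2).
Proof.
move=> Lv; have LX := proj1 (h21_xi bz i).
have LF : L22 (fun p => X1 i p.1 * v p.2) by exact: L22_tensor.
split => // K hK; pose a t := conjc (b2 (ei t)) * v t.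
have La : L21 a.
  have b (t : RT) : I1 t -> sqm (conjc (b2 (ei t))) <= 1 by rewrite sqmJ sqm_blaschke.
  exact: (cL2Ml mI1 (cmeasJ (cmeas_blaschke lam2 w)) b Lv).
rewrite -mean2_swap; last exact: (bperpL1 mB B1 LF (proj1 hK)).
rewrite -[RHS](kernel_perp (z1 i) La (h22_swap hK)); apply: eq_mean2 => p /=.
rewrite /B conjcM -(xi_conj bz) /a; ring.
Qed.

Lemma bperp_eta j (u : R -> C) : L21 u -> bperp B (fun p => X2 j p.2 * u p.1).
Proof.
move=> Lu; have LX := proj1 (h21_xi bw j).
have LF : L22 (fun p => X2 j p.2 * u p.1).
  by apply: L22_eq (L22_tensor Lu LX) => p; rewrite mulrC.
split => // K hK; pose a t := conjc (b1 (ei t)) * u t.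
have La : L21 a.
  have b (t : RT) : I1 t -> sqm (conjc (b1 (ei t))) <= 1 by rewrite sqmJ sqm_blaschke.
  exact: (cL2Ml mI1 (cmeasJ (cmeas_blaschke lam1 z)) b Lu).
rewrite -[RHS](kernel_perp (w1 j) La hK); apply: eq_mean2 => p /=.
rewrite /B conjcM -(xi_conj bw) /a; ring.
Qed.

Section Coefficients.
Variables (c : 'I_n -> 'I_n -> C) (h' h'' : 'I_n -> R -> C).
Hypotheses (hh' : forall j, h21 (h' j)) (hh'' : forall i, h21 (h'' i)).

Local Notation Ke := (Kelt b1 b2 z w c h' h'').

Lemma h22_Kelt : h22 (fun p => Ke p.1 p.2).
Proof.
apply: h22D; first apply: h22D.
- apply: h22_sum => i; apply: h22_sum => j.
  exact: (h22_tensor (h21Z (c i j) (h21_xi bz i)) (h21_xi bw j)).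
- apply: h22_sum => i.
  apply: h22_eq (h22_tensor (h21_xi bz i) (h21_blaschke_mul bw (hh'' i))) => p.
  by rewrite mulrA.
- apply: h22_sum => j.
  apply: h22_eq (h22_tensor (h21_blaschke_mul bz (hh' j)) (h21_xi bw j)) => p.
  by ring.
Qed.

Lemma bperp_Kelt : bperp B (fun p => Ke p.1 p.2).
Proof.
have LX1 i := proj1 (h21_xi bz i); have LX2 j := proj1 (h21_xi bw j).
apply: bperpD => //; first apply: bperpD => //.
- apply: bperp_sum => // i; apply: bperp_sum => // j.
  apply: bperp_eq (bperpZ mB B1 (c i j) (bperp_xi i (LX2 j))) => p.
  by rewrite mulrA.
- apply: bperp_sum => // i.
  apply: bperp_eq (bperp_xi i (proj1 (h21_blaschke_mul bw (hh'' i)))) => p.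
  by rewrite mulrA.
- apply: bperp_sum => // j.
  apply: bperp_eq (bperp_eta j (proj1 (h21_blaschke_mul bz (hh' j)))) => p.
  by rewrite mulrA.
Qed.

Variables (G1 G2 : R -> C).
Hypotheses (hG1 : Hinf G1) (hG2 : Hinf G2).

Local Notation Ga := (Gamma_sup b1 b2 z w G1 G2 c h' h'').

(** In every term at least one of [X1 i], [X2 j] must remain free of [G1], [G2]. The double sum is
    therefore regrouped as [G1 * G2(w_j)], handled by [X2 j], plus [G1(z_i) * (G2 - G2(w_j))],
    handled by [X1 i]. *)
Lemma bperp_Gamma : bperp B (fun p => Ga p.1 p.2).
Proof.
have [bG1 _] := HinfP hG1; have [bG2 _] := HinfP hG2.
have LX1 i := proj1 (h21_xi bz i); have LX2 j := proj1 (h21_xi bw j).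
have L1 i := L21_mul_bounded bG1 (LX1 i); have L2 j := L21_mul_bounded bG2 (LX2 j).
apply: bperpD => //; first apply: bperpD => //.
- apply: bperp_sum => // i; apply: bperp_sum => // j.
  apply: bperp_eq (bperpD mB B1
    (bperpZ mB B1 (c i j * hext G2 (w j)) (bperp_eta j (L1 i)))
    (bperpZ mB B1 (c i j * hext G1 (z i)) (bperp_xi i
       (cL2D mI1 (L2 j) (cL2Z mI1 (- hext G2 (w j)) (LX2 j)))))) => p.
  by ring.
- apply: bperp_sum => // i.
  apply: bperp_eq (bperpZ mB B1 (hext G1 (z i)) (bperp_xi i
    (L21_mul_bounded bG2 (proj1 (h21_blaschke_mul bw (hh'' i)))))) => p.
  by ring.
- apply: bperp_sum => // j.
  apply: bperp_eq (bperpZ mB B1 (hext G2 (w j)) (bperp_eta j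
    (L21_mul_bounded bG1 (proj1 (h21_blaschke_mul bz (hh' j)))))) => p.
  by ring.
Qed.

(** In the double sum the weight of the multiplier differs from [G1 * G2] by the product of
    [G1 - G1(z_i)] and [G2 - G2(w_j)], so a factor [b1] and a factor [b2] come out. The terms with
    [h''] already contain [b2] and need a quotient in [x] only; those with [h'] are symmetric. *)
Lemma G_Kelt : exists r : R * R -> C, h22 r /\ forall x y,
  G1 x * G2 y * Ke x y = Ga x y + b1 (ei x) * b2 (ei y) * r (x, y).
Proof.
have [_ h1] := HinfP hG1; have [_ h2] := HinfP hG2.
pose q1 i := quot (z i) G1; pose q2 j := quot (w j) G2.
have hq1 i : h21 (q1 i) by exact: h21_quot.
have hq2 j : h21 (q2 j) by exact: h21_quot.
exists (fun p => \sum_(i < n) \sum_(j < n) c i j * q1 i p.1 * q2 j p.2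
  + \sum_(i < n) q1 i p.1 * (G2 p.2 * h'' i p.2)
  + \sum_(j < n) (G1 p.1 * h' j p.1) * q2 j p.2).
split.
  apply: h22D; first apply: h22D.
  - apply: h22_sum => i; apply: h22_sum => j.
    exact: (h22_tensor (h21Z (c i j) (hq1 i)) (hq2 j)).
  - by apply: h22_sum => i; exact: (h22_tensor (hq1 i) (h21_mul_Hinf hG2 (hh'' i))).
  - by apply: h22_sum => j; exact: (h22_tensor (h21_mul_Hinf hG1 (hh' j)) (hq2 j)).
move=> x y; rewrite /Kelt /Gamma_sup.
have e1 i : b1 (ei x) * q1 i x = (G1 x - hext G1 (z i)) * X1 i x.
  by rewrite /q1 /quot /xi -[hext G1 (z i)]/(hval (z i) G1); ring.
have e2 j : b2 (ei y) * q2 j y = (G2 y - hext G2 (w j)) * X2 j y.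
  by rewrite /q2 /quot /xi -[hext G2 (w j)]/(hval (w j) G2); ring.
rewrite !mulrDr [in RHS]addrACA; congr (_ + _); first (rewrite [in RHS]addrACA; congr (_ + _)).
- rewrite !mulr_sumr -big_split; apply: eq_bigr => i _ /=.
  rewrite !mulr_sumr -big_split; apply: eq_bigr => j _ /=.
  have -> : b1 (ei x) * b2 (ei y) * (c i j * q1 i x * q2 j y) =
    c i j * (b1 (ei x) * q1 i x) * (b2 (ei y) * q2 j y) by ring.
  by rewrite e1 e2; ring.
- rewrite !mulr_sumr -big_split; apply: eq_bigr => i _ /=.
  have -> : b1 (ei x) * b2 (ei y) * (q1 i x * (G2 y * h'' i y)) =
    (b1 (ei x) * q1 i x) * b2 (ei y) * (G2 y * h'' i y) by ring.
  by rewrite e1; ring.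
- rewrite !mulr_sumr -big_split; apply: eq_bigr => j _ /=.
  have -> : b1 (ei x) * b2 (ei y) * (G1 x * h' j x * q2 j y) =
    (b2 (ei y) * q2 j y) * b1 (ei x) * (G1 x * h' j x) by ring.
  by rewrite e2; ring.
Qed.

End Coefficients.

(* Interpolation at the zeros: [u - sum_i r_i u(z_i) xi_i] vanishes at every [z_i], and
   dividing it by [b1] gives [g u + sum_i r_i (u - u(z_i)) / (x - z_i)], where
   [1 / b1 = g + sum_i r_i / (x - z_i)] on the circle. *)
Lemma h22_decomposition (F : R * R -> C) : h22 F ->
  exists c (h' h'' : 'I_n -> R -> C) (q : R * R -> C),
    [/\ forall j, h21 (h' j), forall i, h21 (h'' i), h22 q &
    forall x y, F (x, y) = Kelt b1 b2 z w c h' h'' x y + b1 (ei x) * b2 (ei y) * q (x, y)].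
Proof.
move=> hF.
have [g1 [r gr1]] := blaschke_inv bz; have [g2 [s gr2]] := blaschke_inv bw.
(* [F2] is [F], interpolated in [y], divided by [b2]; below, [q] is [F2], interpolated in [x],
   divided by [b1]. *)
pose F2 p := g2 * F p + \sum_(j < n) s j * yquot (w j) F p.
have hF2 : h22 F2.
  apply: h22D; first exact: h22Z.
  by apply: h22_sum => j; apply: h22Z; exact: h22_yquot.
pose q p := g1 * F2 p + \sum_(i < n) r i * xquot (z i) F2 p.
have hq : h22 q.
  apply: h22D; first exact: h22Z.
  by apply: h22_sum => i; apply: h22Z; exact: h22_xquot.
(* The values of [F] at [y = w j] are still functions of [x]. Interpolating these at the [z i] gives
   the constants [c], and the quotients [Qk] by [b1] give [h']. *)
pose k j := yslice (w j) F; have hk j : h21 (k j) by exact: h21_yslice.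
pose Qk j t := g1 * k j t + \sum_(i < n) r i * quot (z i) (k j) t.
have hQk j : h21 (Qk j).
  apply: h21D; first exact: h21Z.
  by apply: h21_sum => i; apply: h21Z; exact: h21_quot.
exists (fun i j => r i * s j * hval (z i) (k j)), (fun j t => s j * Qk j t),
  (fun i t => r i * xslice (z i) F2 t), q.
split => //.
- by move=> j; exact: h21Z.
- by move=> i; apply: h21Z; exact: h21_xslice.
move=> x y.
(* Kept pointwise, with arbitrary [u] and [v], since it serves both for [F2], whose values at [z i]
   depend on [y], and for each [k j]. *)
have split1 (u : C) (v : 'I_n -> C) : b1 (ei x) *
    (g1 * u + \sum_(i < n) r i * ((u - v i) / (ei x - z i))) =
    u - \sum_(i < n) r i * v i * X1 i x.
  have -> : g1 * u + \sum_(i < n) r i * ((u - v i) / (ei x - z i)) =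
      (g1 + \sum_(i < n) r i / (ei x - z i)) * u - \sum_(i < n) r i * v i / (ei x - z i).
    rewrite mulrDl mulr_suml -addrA -sumrB; congr (_ + _).
    by apply: eq_bigr => i _; ring.
  rewrite mulrBr mulrA gr1 mul1r mulr_sumr; congr (_ - _).
  by apply: eq_bigr => i _; rewrite /xi; ring.
have split2 (u : C) (v : 'I_n -> C) : b2 (ei y) *
    (g2 * u + \sum_(j < n) s j * ((u - v j) / (ei y - w j))) =
    u - \sum_(j < n) s j * v j * X2 j y.
  have -> : g2 * u + \sum_(j < n) s j * ((u - v j) / (ei y - w j)) =
      (g2 + \sum_(j < n) s j / (ei y - w j)) * u - \sum_(j < n) s j * v j / (ei y - w j).
    rewrite mulrDl mulr_suml -addrA -sumrB; congr (_ + _).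
    by apply: eq_bigr => j _; ring.
  rewrite mulrBr mulrA gr2 mul1r mulr_sumr; congr (_ - _).
  by apply: eq_bigr => j _; rewrite /xi; ring.
have eq1 : b1 (ei x) * q (x, y) = F2 (x, y) - \sum_(i < n) r i * xslice (z i) F2 y * X1 i x.
  exact: split1.
have eq2 : b2 (ei y) * F2 (x, y) = F (x, y) - \sum_(j < n) s j * k j x * X2 j y.
  exact: (split2 (F (x, y)) (fun j => k j x)).
have eqk j : b1 (ei x) * Qk j x = k j x - \sum_(i < n) r i * hval (z i) (k j) * X1 i x.
  exact: split1.
rewrite /Kelt.
have -> : b1 (ei x) * b2 (ei y) * q (x, y) = F (x, y) - \sum_(j < n) s j * k j x * X2 j y
    - \sum_(i < n) X1 i x * b2 (ei y) * (r i * xslice (z i) F2 y).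
  rewrite mulrAC eq1 mulrBl [F2 _ * _]mulrC eq2; congr (_ - _).
  by rewrite mulr_suml; apply: eq_bigr => i _; ring.
have -> : \sum_(j < n) s j * k j x * X2 j y =
    \sum_(i < n) \sum_(j < n) r i * s j * hval (z i) (k j) * X1 i x * X2 j y +
    \sum_(j < n) X2 j y * b1 (ei x) * (s j * Qk j x).
  rewrite exchange_big -big_split; apply: eq_bigr => j _ /=.
  have -> : X2 j y * b1 (ei x) * (s j * Qk j x) = X2 j y * s j * (b1 (ei x) * Qk j x) by ring.
  rewrite eqk mulrBr mulr_sumr addrCA -sumrB big1 ?addr0; first by ring.
  by move=> i _; ring.
by ring.
Qed.

End MainIdentities.

(** * Equality of the two norms *)

Theorem theorem6p2 (R : realType) (n : nat) (lam1 lam2 : complex R)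
  (z w : 'I_n -> complex R) (G1 G2 : R -> complex R) :
  is_blaschke_simple lam1 z -> is_blaschke_simple lam2 w ->
  Hinf G1 -> Hinf G2 ->
  Gamma_sup_norm (blaschke lam1 z) (blaschke lam2 w) z w G1 G2 =
  hankel_norm (fun x y => (blaschke lam1 z (ei x))^*%C *
                          (blaschke lam2 w (ei y))^*%C * G1 x * G2 y).
Proof.
move=> bz bw hG1 hG2.
set b1 := blaschke lam1 z; set b2 := blaschke lam2 w.
set phi := (fun x y => _).
pose B (p : R * R) := b1 (ei p.1) * b2 (ei p.2).
have mB : cmeas2 B.
  by apply: cmeasM; [exact: (cmeas_fst (cmeas_blaschke lam1 z))|exact: (cmeas_snd (cmeas_blaschke lam2 w))].
have B1 p : sqm (B p) = 1 by rewrite /B sqmM !sqm_blaschke ?mulr1.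
have BJ p : conjc (B p) * B p = 1 by rewrite mulrC mul_conjc B1.
have phiE x y : phi x y = conjc (B (x, y)) * (G1 x * G2 y).
  by rewrite /phi /B conjcM !mulrA.
have GL F : h22 F -> h22 (fun p => G1 p.1 * G2 p.2 * F p).
  move=> hF; apply: h22_eq (h22_mul_Hinf hG1 (h22_mul_Hinf_snd hG2 hF)) => p.
  by rewrite mulrA.
(* [Gamma] is the remainder of [phi * f] once [f] is reduced modulo [B H^2]. *)
have key c h' h'' q f : (forall j, h21 (h' j)) -> (forall i, h21 (h'' i)) -> h22 q ->
    (forall x y, f x y = Kelt b1 b2 z w c h' h'' x y + B (x, y) * q (x, y)) ->
    exists k : R -> R -> complex R,
      [/\ L22 (fun p => phi p.1 p.2 * f p.1 p.2),
      is_projH2 (fun x y => phi x y * f x y) k &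
      nsq2 (fun p => phi p.1 p.2 * f p.1 p.2 - k p.1 p.2) =
      nsq2 (fun p => Gamma_sup b1 b2 z w G1 G2 c h' h'' p.1 p.2)].
  move=> hh' hh'' hq fE.
  have [r [hr rE]] := G_Kelt bz bw c hh' hh'' hG1 hG2.
  have oG := bperp_Gamma bz bw c hh' hh'' hG1 hG2.
  (* [k] gathers the terms in which [B] cancels [conjc B]; what is left of [phi * f] is [conjc B]
     times the multiplier, orthogonal to H^2. *)
  pose k x y := r (x, y) + G1 x * G2 y * q (x, y).
  have hk : h22 (fun p => k p.1 p.2).
    by apply: h22_eq (h22D hr (GL _ hq)) => -[x y].
  have E (p : R * R) : phi p.1 p.2 * f p.1 p.2 = conjc (B p) *
      Gamma_sup b1 b2 z w G1 G2 c h' h'' p.1 p.2 + k p.1 p.2.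
    case: p => x y /=; rewrite phiE fE /k.
    transitivity (conjc (B (x, y)) * (G1 x * G2 y * Kelt b1 b2 z w c h' h'' x y)
      + (conjc (B (x, y)) * B (x, y)) * (G1 x * G2 y * q (x, y))); first by ring.
    rewrite BJ mul1r rE mulrDr -[b1 _ * b2 _]/(B (x, y)) [_ * (B _ * _)]mulrA BJ mul1r.
    by rewrite addrA.
  have E' (p : R * R) : phi p.1 p.2 * f p.1 p.2 - k p.1 p.2 = conjc (B p) *
      Gamma_sup b1 b2 z w G1 G2 c h' h'' p.1 p.2 by rewrite E addrK.
  exists k; split.
  - apply: L22_eq (cL2D (@mI2 R) (L22_conjB mB B1 (proj1 oG)) (proj1 hk)) => p.
    by rewrite E.
  - split; first exact/H2_2P.
    move=> K /H2_2P hK; rewrite -[RHS](proj2 oG _ hK).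
    by rewrite /inner2 cint2E; apply: eq_mean2 => p; rewrite E'.
  - by rewrite -[RHS](nsq2_conjB B1); congr nsq2; apply/funext => p; rewrite E'.
have L2norm (f : R -> R -> complex R) : L22 (fun p => f p.1 p.2) -> l2norm2 f = Num.sqrt (nsq2 (fun p => f p.1 p.2)).
  by move=> Lf; apply: l2norm2E; exact/L2_2P.
(* The suprema are equal because the two sets of values are: [f = e] with [q = 0] in one direction,
   the model component of [f] in the other. *)
rewrite /Gamma_sup_norm /hankel_norm; congr ereal_sup; apply/seteqP; split.
  move=> _ [c [h' [h'' [/= hh' hh'' nK ->]]]].
  have {}hh' j : h21 (h' j) by apply/H2_1P.
  have {}hh'' i : h21 (h'' i) by apply/H2_1P.
  have hK := h22_Kelt bz bw c hh' hh''.
  have [|k [Lphi pk ek]] := key c h' h'' (fun=> 0) (Kelt b1 b2 z w c h' h'') hh' hh'' (h22_cst0 R).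
    by move=> x y; rewrite mulr0 addr0.
  exists (Kelt b1 b2 z w c h' h''), k; split => //; first exact/H2_2P.
  rewrite !L2norm ?ek //; last exact: (proj1 (bperp_Gamma bz bw c hh' hh'' hG1 hG2)).
  by apply: (cL2B (@mI2 R)) => //; have [/H2_2P[]] := pk.
move=> _ [f [k [/H2_2P hf nf pk ->]]].
have [c [h' [h'' [q [hh' hh'' hq fE]]]]] := h22_decomposition bz bw hf.
have [k' [Lphi pk' ek]] := key c h' h'' q f hh' hh'' hq fE.
have oK := bperp_Kelt bz bw c hh' hh''.
exists c, h', h''; split.
- by move=> j; apply/H2_1P.
- by move=> i; apply/H2_1P.
- apply: le_trans nf; rewrite (L2norm _ (proj1 oK)) (L2norm _ (proj1 hf)).
  apply: ler_wsqrtr.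
  (* [q] is a projection of [conjc B * f], with remainder [conjc B * e]; comparison with the
     competitor 0 in H^2 gives [|e| <= |f|]. *)
  pose g x y := conjc (B (x, y)) * f x y; pose q' x y := q (x, y).
  have Lg : L22 (fun p => g p.1 p.2).
    by apply: L22_eq (L22_conjB mB B1 (proj1 hf)) => -[x y].
  have gE p : g p.1 p.2 - q' p.1 p.2 = conjc (B p) * Kelt b1 b2 z w c h' h'' p.1 p.2.
    case: p => x y; rewrite /g /q' /= fE mulrDr -[b1 _ * b2 _]/(B (x, y)) [_ * (B _ * _)]mulrA BJ mul1r.
    by rewrite addrK.
  have hq' : h22 (fun p => q' p.1 p.2) by apply: h22_eq hq => -[x y].
  have pg : is_projH2 g q'.
    split; first exact/H2_2P.
    move=> K /H2_2P hK; rewrite -[RHS](proj2 oK _ hK).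
    by rewrite /inner2 cint2E; apply: eq_mean2 => p; rewrite gE.
  have := proj_min Lg pg (h22_cst0 R : h22 (fun p => (fun _ _ => 0) p.1 p.2)).
  have -> : nsq2 (fun p => g p.1 p.2 - q' p.1 p.2) =
      nsq2 (fun p => Kelt b1 b2 z w c h' h'' p.1 p.2).
    by rewrite -[RHS](nsq2_conjB B1); congr nsq2; apply/funext => p; rewrite gE.
  have -> // : nsq2 (fun p => g p.1 p.2 - 0) = nsq2 (fun p => f p.1 p.2).
  by rewrite -[RHS](nsq2_conjB B1); congr nsq2; apply/funext => -[x y]; rewrite subr0.
- have Lk : L22 (fun p => k p.1 p.2) by have [/H2_2P[]] := pk.
  rewrite !L2norm //; last 2 first.
  + exact: (proj1 (bperp_Gamma bz bw c hh' hh'' hG1 hG2)).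
  + exact: (cL2B (@mI2 R)).
  (* The given projection [k] need not be the explicit [k'], but the remainders have equal norms. *)
  by rewrite (proj_nsq_unique Lphi pk pk') ek.
Qed.
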